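(* Let $\ell=v_\pi(2)$. Let $Q=\bigoplus_{i\in\mathbb N}\pi^iQ_i\oplus L+c$, where each $Q_i$ is a unimodular quadratic form of rank $r_i$ over $R$, there is a positive integer $\omega$ with $Q_i=0$ for $i>\omega$, $L$ is a linear form involving at most one indeterminate (all in disjoint variables), and $c\in R$. Define $Q_{(j)}=\bigoplus_{0\le i\le j,\ i\equiv j\ (\mathrm{mod}\ 2)}Q_i$, $r_{(j)}=\sum_{0\le i\le j,\ i\equiv j\ (\mathrm{mod}\ 2)}r_i$, $q_{(j)}=q^{\sum_{0\le i<j}r_{(i)}}$. For a quadratic form $P$ let $G_P$ be its $p$-adic generating function and $H_P$ its head. For $a\in R$, $\mu\in\mathbb N$ and quadratic forms $P_0,\dots,P_{2\ell}$ let $I_a(P_0,\dots,P_{2\ell})=\mathrm{Ig}\big(z^aH_{P_0}(z)G_{P_1}(z^\pi)\cdots G_{P_{2\ell}}(z^{\pi^{2\ell}})\big)$ and $I_a^\mu(P_0,\dots,P_{2\ell})=\mathrm{Ig}\big(z^{a+\pi^\mu R}H_{P_0}(z)G_{P_1}(z^\pi)\cdots G_{P_{2\ell}}(z^{\pi^{2\ell}})\big)$. Write $\mathbf Q_i=(Q_{(i)},Q_{(i+1)},Q_{i+2},Q_{i+3},\dots,Q_{i+2\ell})$. Then the Igusa local zeta function $Z_Q(t)$ is: (1) If $L=0$ and $c=0$: with $r=\sum_ir_i$, $$Z_Q(t)=\sum_{0\le i<\omega-1}\frac{t^i}{q_{(i)}}I_0(\mathbf Q_i)+\left(\frac{t^{\omega-1}}{q_{(\omega-1)}}I_0(Q_{(\omega-1)},Q_{(\omega)},0,\dots,0)+\frac{t^{\omega}}{q_{(\omega)}}I_0(Q_{(\omega)},Q_{(\omega-1)},0,\dots,0)\right)\left(1-\frac{t^2}{q^r}\right)^{-1}.$$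 (2) If $L(x)=bx$ with $v_\pi(b)=\lambda<\infty$ and $v_\pi(b)\le v_\pi(c)$: $$Z_Q(t)=\sum_{0\le i<\lambda-2\ell}\frac{t^i}{q_{(i)}}I_0(\mathbf Q_i)+\sum_{\max\{0,\lambda-2\ell\}\le i<\lambda}\frac{t^i}{q_{(i)}}I_0^{\lambda-i}(\mathbf Q_i)+\frac{t^\lambda}{q_{(\lambda)}}\cdot\frac{1-1/q}{1-t/q}.$$ (3) If $L(x)=bx$ with $v_\pi(b)=\lambda<\infty$ and $v_\pi(c)<v_\pi(b)\le v_\pi(c)+2\ell$, with $\kappa=v_\pi(c)$: $$Z_Q(t)=\sum_{0\le i<\lambda-2\ell}\frac{t^i}{q_{(i)}}I_{c/\pi^i}(\mathbf Q_i)+\sum_{\max\{0,\lambda-2\ell\}\le i\le\kappa}\frac{t^i}{q_{(i)}}I_{c/\pi^i}^{\lambda-i}(\mathbf Q_i)+\frac{t^\kappa}{q_{(\kappa+1)}}.$$ (4) If $L(x)=bx$ with $v_\pi(b)>v_\pi(c)+2\ell$ (this includes $L=0$, $c\ne0$), with $\kappa=v_\pi(c)$: $$Z_Q(t)=\sum_{0\le i\le\kappa}\frac{t^i}{q_{(i)}}I_{c/\pi^i}(\mathbf Q_i)+\frac{t^\kappa}{q_{(\kappa+1)}}.$$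
   Context: $K$ is a $p$-adic field with valuation ring $R$, uniformizer $\pi$, residue field of order $q$, valuation $v_\pi$ ($v_\pi(0)=\infty$). A quadratic form over $R$ is $x^TMx$ with $M$ symmetric over $R$; unimodular means $\det M\in R^*$ (the zero form is unimodular of rank 0); $\oplus$ is a sum in disjoint variables. $R_k=R/\pi^kR$; $\mathcal A_k$ is the complex group algebra of $(R_k,+)$ with basis $\gamma^A$; $\mathcal G$ is the inverse limit of the $\mathcal A_k$ under reduction maps, with projections $\phi_k$; $\phi_k(F)=\sum F_A\gamma^A$, $F(1)=\sum_AF_A$. The $p$-adic generating function of $f\in R[x_1,\dots,x_n]$ has $\phi_k$-image $q^{-nk}\sum_{A\in R_k^n}\gamma^{f(A)}$; for homogeneous $f$, its head has $\phi_k$-image $q^{-nk}\sum_{A\in R_k^n,\ A\not\equiv0\ (\mathrm{mod}\ \pi)}\gamma^{f(A)}$ ($k\ge1$). For $A$ a coset $a+\pi^jR$ or singleton $\{a\}$, $z^A$ has $\phi_k(z^A)=N^{-1}\sum_{C\in R_k,\ C\cap A\ne\emptyset}\gamma^C$; $z^a:=z^{\{a\}}$. For $s\in R$, $F(z^s)$ has $\phi_k$-image $F(1)\gamma^{\pi^kR}$ if $k\le v_\pi(s)$ and $\sum_{A\in R_{k-v_\pi(s)}}F_A\gamma^{sA}$ if $k\ge v_\pi(s)$. $\mathrm{Ig}:\mathcal G\to\mathbb C[[t]]$, $\mathrm{Ig}(F)=\sum_{k\ge0}(F_{\pi^kR}-F_{\pi^{k+1}R})t^k$ with $F_{\pi^kR}$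 the coefficient of $\gamma^{\pi^kR}$ in $\phi_k(F)$; $\mathrm{Ig}$ of the generating function of $f$ is its Igusa local zeta function $Z_f(t)=\sum_k\mathrm{Vol}\{x\in R^n:v_\pi(f(x))=k\}t^k$, $t=q^{-s}$. *)

(* Defs.v *)
From HB Require Import structures.
From mathcomp Require Import all_boot all_order all_algebra.
From mathcomp Require Import generic_quotient ring_quotient zify ring lra.
From mathcomp Require Import all_classical all_reals measure complex.

Set Implicit Arguments.
Unset Strict Implicit.
Unset Printing Implicit Defensive.

Import Order.TTheory GRing.Theory Num.Theory.

Local Open Scope classical_set_scope.
Local Open Scope ring_scope.

(* dv_unif is a uniformizer, so dv_val is onto Z and +oo (normalized). *)
Record dvField := DVField {
  dv_sort :> fieldType;
  dv_val : dv_sort -> \bar int;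
  dv_unif : dv_sort;
  dv_val_eqy : forall x, (dv_val x == +oo%E) = (x == 0);
  dv_val_neqNy : forall x, dv_val x != -oo%E;
  dv_valM : forall x y, dv_val (x * y) = (dv_val x + dv_val y)%E;
  dv_valD : forall x y, (Order.min (dv_val x) (dv_val y) <= dv_val (x + y))%E;
  dv_val_unif : dv_val dv_unif = 1%:E
}.

Section ValuationTheory.
Variable K : dvField.
Local Notation v := (@dv_val K).

Definition ordz (x : K) : int := if v x is n%:E%E then n else 0.

Lemma dv_valE x : x != 0 -> v x = (ordz x)%:E.
Proof.
rewrite /ordz => x0; have := dv_val_eqy x; have := dv_val_neqNy x.
by rewrite (negPf x0); case: (v x).
Qed.

Lemma dv_val0 : v 0 = +oo%E.
Proof. by apply/eqP; rewrite dv_val_eqy. Qed.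

Lemma ordzM x y : x != 0 -> y != 0 -> ordz (x * y) = ordz x + ordz y.
Proof.
move=> x0 y0; have := dv_valM x y.
by rewrite !dv_valE ?mulf_neq0 // -EFinD => -[].
Qed.

Lemma ordz1 : ordz 1 = 0.
Proof.
have := ordzM (oner_neq0 K) (oner_neq0 K); rewrite mulr1.
by move: (ordz 1) => n h; lia.
Qed.

Lemma dv_val1 : v 1 = 0%E.
Proof. by rewrite dv_valE ?oner_neq0 // ordz1. Qed.

Lemma dv_valN x : v (- x) = v x.
Proof.
have [->|x0] := eqVneq x 0; first by rewrite oppr0.
have N1 : (-1 : K) != 0 by rewrite oppr_eq0 oner_neq0.
have h : ordz (-1) = 0.
  by have := ordzM N1 N1; rewrite mulrNN mulr1 ordz1; lia.
by rewrite -mulN1r !dv_valE ?mulf_neq0 // ordzM // h add0r.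
Qed.

Lemma dv_valD_ge (a : \bar int) x y :
  (a <= v x)%E -> (a <= v y)%E -> (a <= v (x + y))%E.
Proof.
by move=> ax ay; apply: le_trans (dv_valD x y); rewrite le_min ax ay.
Qed.

Lemma unif_neq0 : dv_unif K != 0.
Proof. by rewrite -dv_val_eqy dv_val_unif. Qed.

Lemma ordzX (k : nat) : ordz (dv_unif K ^+ k) = k.
Proof.
elim: k => [|k IH]; first by rewrite expr0 ordz1.
rewrite exprS ordzM ?expf_neq0 ?unif_neq0 // IH.
by rewrite {1}/ordz dv_val_unif; lia.
Qed.

Lemma dv_valX (k : nat) : v (dv_unif K ^+ k) = k%:Z%:E.
Proof. by rewrite dv_valE ?expf_neq0 ?unif_neq0 // ordzX. Qed.

Definition vint : {pred K} := fun x => (0 <= v x)%E.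

Lemma vintE x : (x \in vint) = (0 <= v x)%E.
Proof. by []. Qed.

Lemma vint_subring : subring_closed vint.
Proof.
split=> [|x y|x y]; rewrite !vintE ?dv_val1 // => x0 y0.
  by apply: dv_valD_ge => //; rewrite dv_valN.
by rewrite dv_valM adde_ge0.
Qed.

HB.instance Definition _ := GRing.isSubringClosed.Build K vint vint_subring.

Record valring := ValRing { rval : K; rvalP : rval \in vint }.

HB.instance Definition _ := [isSub for rval].
HB.instance Definition _ := [Choice of valring by <:].
HB.instance Definition _ := [SubChoice_isSubComNzRing of valring by <:].

Definition vr_unit : pred valring := fun x => v (val x) == 0%E.
Definition vr_inv (x : valring) : valring :=
  if vr_unit x then insubd x (val x)^-1 else x.

Lemma dv_valV x : x != 0 -> v x^-1 = (- ordz x)%:E.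
Proof.
move=> x0; have := ordzM x0 (invr_neq0 x0); rewrite divff // ordz1.
by rewrite dv_valE ?invr_neq0 // => h; congr (_%:E); lia.
Qed.

Lemma vr_unit_neq0 x : vr_unit x -> val x != 0.
Proof. by rewrite /vr_unit -dv_val_eqy => /eqP->. Qed.

Lemma val_vr_inv x : vr_unit x -> val (vr_inv x) = (val x)^-1.
Proof.
move=> ux; rewrite /vr_inv ux insubdK // vintE dv_valV ?vr_unit_neq0 //.
by move: ux; rewrite /vr_unit /ordz => /eqP->; rewrite oppr0.
Qed.

Lemma vr_mulVx : {in vr_unit, left_inverse 1 vr_inv *%R}.
Proof.
move=> x ux; apply: val_inj; rewrite rmorphM rmorph1 /= val_vr_inv //.
by rewrite mulVf ?vr_unit_neq0.
Qed.

Lemma vr_unitPl (x y : valring) : y * x = 1 -> vr_unit x.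
Proof.
move=> /(congr1 val); rewrite rmorphM rmorph1 /= => xy1.
have y0 : val y != 0.
  by apply/eqP => y0; move: xy1 (oner_neq0 K); rewrite y0 mul0r => <-; rewrite eqxx.
have x0 : val x != 0.
  by apply/eqP => x0; move: xy1 (oner_neq0 K); rewrite x0 mulr0 => <-; rewrite eqxx.
have := ordzM y0 x0; rewrite xy1 ordz1 => h.
have := valP x; have := valP y; rewrite !vintE /vr_unit !dv_valE // !lee_fin.
by move=> hx hy; apply/eqP; congr (_%:E); lia.
Qed.

Lemma vr_inv_out : {in [predC vr_unit], vr_inv =1 id}.
Proof. by move=> x; rewrite inE /= /vr_inv /in_mem /= => /negPf->. Qed.

HB.instance Definition _ := GRing.ComNzRing_hasMulInverse.Build valring
  vr_mulVx vr_unitPl vr_inv_out.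

Lemma vr_integral (x y : valring) : x * y = 0 -> (x == 0) || (y == 0).
Proof.
by move=> /(congr1 val)/eqP; rewrite rmorphM rmorph0 /= mulf_eq0 -!(inj_eq val_inj).
Qed.

HB.instance Definition _ := GRing.ComUnitRing_isIntegral.Build valring vr_integral.

HB.instance Definition _ := isPointed.Build valring 0.

End ValuationTheory.

Section Residues.
Variable K : dvField.
Local Notation R := (valring K).

Definition vpi (x : R) : \bar int := dv_val (val x).

Lemma unif_vint : dv_unif K \in @vint K.
Proof. by rewrite vintE dv_val_unif. Qed.

Definition vr_unif : R := ValRing unif_vint.

(* The quotient x / y in R, when y divides x (junk value 0 otherwise). *)
Definition vr_div (x y : R) : R := insubd 0 (val x / val y).

Definition unif_ideal (k : nat) : {pred R} :=
  fun x => `[< exists y, x = vr_unif ^+ k * y >].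

Lemma unif_idealP k x :
  reflect (exists y, x = vr_unif ^+ k * y) (x \in unif_ideal k).
Proof. exact: asboolP. Qed.

Lemma val_vrM (x y : R) : val (x * y) = val x * val y.
Proof. by []. Qed.

Lemma val_unifX k : val (vr_unif ^+ k) = dv_unif K ^+ k.
Proof. by rewrite rmorphXn. Qed.

Lemma unif_idealE k x : (x \in unif_ideal k) = (k%:Z%:E <= vpi x)%E.
Proof.
rewrite /vpi; apply/unif_idealP/idP => [[y ->]|kx].
  rewrite val_vrM dv_valM val_unifX dv_valX.
  by rewrite leeDl //; exact: valP y.
have [x0|x0] := eqVneq (val x) 0.
  by exists 0; rewrite mulr0; apply: val_inj; rewrite x0 rmorph0.
have pk0 : dv_unif K ^+ k != 0 by rewrite expf_neq0 ?unif_neq0.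
have xk : val x / dv_unif K ^+ k \in @vint K.
  move: kx; rewrite vintE dv_valM dv_valV // ordzX dv_valE // -EFinD !lee_fin.
  lia.
exists (ValRing xk); apply: val_inj; rewrite val_vrM val_unifX /=.
by rewrite mulrC divfK.
Qed.

Lemma unif_ideal_zmod k : zmod_closed (unif_ideal k).
Proof.
split=> [|x y]; rewrite !unif_idealE /vpi ?rmorph0 ?dv_val0 ?leey //.
by rewrite rmorphB => kx ky; apply: dv_valD_ge => //; rewrite dv_valN.
Qed.

HB.instance Definition _ k :=
  GRing.isZmodClosed.Build R (unif_ideal k) (unif_ideal_zmod k).

Lemma unif_idealMr k x y : y \in unif_ideal k -> x * y \in unif_ideal k.
Proof.
move=> /unif_idealP[z ->]; apply/unif_idealP.
by exists (x * z); rewrite mulrCA.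
Qed.

Lemma unif_ideal_le j k x : (j <= k)%N -> x \in unif_ideal k -> x \in unif_ideal j.
Proof.
by rewrite !unif_idealE => jk; apply: le_trans; rewrite lee_fin; lia.
Qed.

Lemma unif_ideal0 x : x \in unif_ideal 0.
Proof. by rewrite unif_idealE; exact: valP x. Qed.

Definition Rmod (k : nat) : Type := {ideal_quot unif_ideal k}.

HB.instance Definition _ k := EqQuotient.on (Rmod k).
HB.instance Definition _ k := Choice.on (Rmod k).
HB.instance Definition _ k := GRing.Zmodule.on (Rmod k).

Definition cls (k : nat) (x : R) : Rmod k := \pi_(Rmod k)%qT x.
Definition rep (k : nat) (A : Rmod k) : R := repr A.

Lemma repK k : cancel (@rep k) (@cls k).
Proof. exact: reprK. Qed.

Lemma clsE k x y : (cls k x == cls k y) = (x - y \in unif_ideal k).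
Proof. by rewrite Quotient.idealrBE. Qed.

Lemma cls_eq k x y : x - y \in unif_ideal k -> cls k x = cls k y.
Proof. by rewrite -clsE => /eqP. Qed.

Lemma cls_is_zmod k : zmod_morphism (@cls k).
Proof. by move=> x y; rewrite /cls; exact: (raddfB (\pi_({ideal_quot unif_ideal k}))%qT). Qed.

HB.instance Definition _ k := GRing.isZmodMorphism.Build R (Rmod k) (@cls k) (@cls_is_zmod k).

Lemma rep_cls k x : rep (cls k x) - x \in unif_ideal k.
Proof. by rewrite -clsE repK. Qed.

Definition Rmod_mul k (A B : Rmod k) : Rmod k := cls k (rep A * rep B).

Lemma cls_mul k : {morph @cls k : x y / x * y >-> Rmod_mul x y}.
Proof.
move=> x y; apply/eqP; rewrite eq_sym /Rmod_mul clsE.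
set a := rep _; set b := rep _.
have -> : a * b - x * y = b * (a - x) + x * (b - y) by ring.
by rewrite rpredD // unif_idealMr // rep_cls.
Qed.

Lemma Rmod_mulA k : associative (@Rmod_mul k).
Proof. by move=> A B C; rewrite -[A]repK -[B]repK -[C]repK -!cls_mul mulrA. Qed.
Lemma Rmod_mulC k : commutative (@Rmod_mul k).
Proof. by move=> A B; rewrite /Rmod_mul mulrC. Qed.
Lemma Rmod_mul1 k : left_id (cls k 1) (@Rmod_mul k).
Proof. by move=> A; rewrite -[A]repK -!cls_mul mul1r. Qed.
Lemma Rmod_mulDl k : left_distributive (@Rmod_mul k) +%R.
Proof.
by move=> A B C; rewrite -[A]repK -[B]repK -[C]repK -raddfD -!cls_mul mulrDl raddfD.
Qed.

HB.instance Definition _ k := GRing.Zmodule_isComPzRing.Build (Rmod k)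
  (@Rmod_mulA k) (@Rmod_mulC k) (@Rmod_mul1 k) (@Rmod_mulDl k).

Lemma cls_is_monoid k : monoid_morphism (@cls k).
Proof. by split=> // x y; rewrite cls_mul. Qed.

HB.instance Definition _ k := GRing.isMonoidMorphism.Build R (Rmod k) (@cls k) (@cls_is_monoid k).

(* The reduction map R_k -> R_j, meaningful for j <= k only. *)
Definition redmod k j (A : Rmod k) : Rmod j := cls j (rep A).

Lemma redmod_cls k j x : (j <= k)%N -> redmod j (cls k x) = cls j x.
Proof. by move=> jk; apply/cls_eq/(unif_ideal_le jk)/rep_cls. Qed.

Lemma redmodK k (A : Rmod k) : redmod k A = A.
Proof. exact: repK. Qed.

Lemma redmod_comp i j k (A : Rmod k) : (i <= j)%N -> (j <= k)%N ->
  redmod i (redmod j A) = redmod i A.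
Proof. by move=> ij jk; rewrite redmod_cls. Qed.

End Residues.

(* p-adic fields (finite extensions of some Q_p) are the fields of
   characteristic 0 that are complete for a discrete valuation with finite
   residue field. *)
Record padicField := PadicField {
  pf_dv :> dvField;
  pf_char0 : [pchar pf_dv] =i pred0;
  pf_residue_finite : finite_set [set: Rmod pf_dv 1];
  pf_complete : forall u : nat -> pf_dv,
    (forall N : int, exists n0 : nat, forall m n : nat,
        (n0 <= m)%N -> (n0 <= n)%N -> (N%:E <= dv_val (u m - u n))%E) ->
    exists l : pf_dv, forall N : int, exists n0 : nat, forall n : nat,
        (n0 <= n)%N -> (N%:E <= dv_val (u n - l))%E
}.

Section FiniteResidues.
Variable K : padicField.
Local Notation R := (valring K).
Local Notation Rmod k := (Rmod K k).

Lemma Rmod_finite k : exists s : seq (Rmod k), forall A, A \in s.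
Proof.
have /finite_seqP[s1 hs1] := pf_residue_finite K.
have {}hs1 B : B \in s1 by have : [set` s1] B by rewrite -hs1.
elim: k => [|k [s hs]].
  exists [:: 0] => A; rewrite inE -[A]repK -(raddf0 (cls 0)); apply/eqP/cls_eq.
  exact: unif_ideal0.
exists [seq cls k.+1 (rep A + vr_unif K ^+ k * rep B) | A <- s, B <- s1] => C.
apply/allpairsP; have := rep_cls k (rep C).
rewrite -rpredN opprB => /unif_idealP[y hy].
exists (redmod k C, cls 1 y); split=> //=.
rewrite -[LHS]repK; apply/cls_eq; rewrite opprD addrA hy -mulrBr.
have := rep_cls 1 y; rewrite -rpredN opprB => /unif_idealP[z ->].
by apply/unif_idealP; exists z; rewrite mulrA -exprD addn1.
Qed.

Definition Rmod_enum k : seq (Rmod k) := undup (sval (cid (Rmod_finite k))).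

Lemma mem_Rmod_enum k A : A \in Rmod_enum k.
Proof. by rewrite mem_undup; exact: (svalP (cid (Rmod_finite k))). Qed.

Lemma Rmod_pickleK k :
  cancel (fun A : Rmod k => index A (Rmod_enum k)) (nth 0 (Rmod_enum k)).
Proof. by move=> A; rewrite nth_index ?mem_Rmod_enum. Qed.

HB.instance Definition _ k := CanIsCountable (@Rmod_pickleK k).

Lemma Rmod_enumP k : Finite.axiom (Rmod_enum k).
Proof. by move=> A; rewrite count_uniq_mem ?undup_uniq // mem_Rmod_enum. Qed.

HB.instance Definition _ k := fintype.isFinite.Build (Rmod k) (@Rmod_enumP k).

Definition resq : nat := #|{: Rmod 1}|.

Lemma resq_gt0 : (0 < resq)%N.
Proof. by apply/card_gt0P; exists 0. Qed.

Lemma redmodB j k : (j <= k)%N ->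
  {morph @redmod K k j : A B / A - B}.
Proof.
by move=> jk A B; rewrite -[A]repK -[B]repK -raddfB !redmod_cls // raddfB.
Qed.

Lemma redmod_surj j k (B : Rmod j) : (j <= k)%N -> exists A : Rmod k, redmod j A = B.
Proof. by move=> jk; exists (cls k (rep B)); rewrite redmod_cls // repK. Qed.

Lemma card_fib (U V : finZmodType) (f : U -> V) (P : pred U) (Q : pred V) :
  {morph f : x y / x - y} ->
  (forall x y z, P x -> P y -> P z -> P (x - y + z)) ->
  (forall y, Q y <-> exists2 x, P x & f x = y) ->
  (exists x, P x) ->
  exists2 N : nat, (0 < N)%N &
    #|P| = (N * #|Q|)%N /\ forall y, Q y -> #|[pred x | P x && (f x == y)]| = N.
Proof.
move=> fB Paff PQ [x0 Px0].
have f0 : f 0 = 0 by rewrite -(subrr 0) fB subrr.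
have fN x : f (- x) = - f x by rewrite -sub0r fB f0 sub0r.
have fD x y : f (x + y) = f x + f y by rewrite -{1}[y]opprK fB fN opprK.
have le y1 y2 : Q y1 -> Q y2 ->
    (#|[pred x | P x && (f x == y1)]| <= #|[pred x | P x && (f x == y2)]|)%N.
  move=> /PQ[a1 Pa1 <-] /PQ[a2 Pa2 <-].
  rewrite -(fintype.card_image (addrI (a2 - a1))); apply/subset_leq_card/fintype.subsetP => z.
  move=> /fintype.imageP[x]; rewrite !inE => /andP[Px /eqP fx] ->.
  by rewrite Paff //= fD fB fx subrK.
have Qx0 : Q (f x0) by apply/PQ; exists x0.
exists #|[pred x | P x && (f x == f x0)]|.
  by apply/card_gt0P; exists x0; rewrite inE Px0 eqxx.
have eqN y : Q y -> #|[pred x | P x && (f x == y)]| = #|[pred x | P x && (f x == f x0)]|.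
  by move=> Qy; apply/eqP; rewrite eqn_leq !le.
split=> //; rewrite -sum1_card (partition_big f Q) /=; last first.
  by move=> x Px; apply/PQ; exists x.
rewrite mulnC -sum_nat_const; apply: eq_bigr => y Qy.
by rewrite sum1_card; rewrite -(eqN y Qy); apply: eq_card.
Qed.

Lemma card_Rmod k : #|{: Rmod k}| = (resq ^ k)%N.
Proof.
elim: k => [|k IH].
  apply/eqP; rewrite expn0; apply/fintype1P; exists 0 => A.
  by rewrite -[A]repK -(raddf0 (cls 0)); apply/cls_eq/unif_ideal0.
have [||||N N0 [cN fN]] := @card_fib (Rmod k.+1) (Rmod k) (redmod k) predT predT.
- exact/redmodB.
- by [].
- move=> B; split=> // _; have [A <-] := @redmod_surj k k.+1 B (leqnSn k).
  by exists A.
- by exists 0.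
have {cN} -> : #|{: Rmod k.+1}| = (N * #|{: Rmod k}|)%N by exact: cN.
rewrite IH expnS; congr (_ * _)%N; rewrite -(fN 0) //.
pose g (B : Rmod 1) : Rmod k.+1 := cls k.+1 (vr_unif K ^+ k * rep B).
have unifXI : injective ( *%R (vr_unif K ^+ k)).
  apply: mulfI; rewrite expf_neq0 // -(inj_eq val_inj) /=; exact: unif_neq0.
have gI : injective g.
  move=> B C /eqP; rewrite clsE -mulrBr => /unif_idealP[z].
  rewrite exprSr -mulrA => /unifXI h; rewrite -[B]repK -[C]repK; apply/cls_eq.
  by apply/unif_idealP; exists z; rewrite h.
rewrite /resq -(card_codom gI); apply: eq_card => C; rewrite !inE.
apply/eqP/codomP => [|[B ->]]; last first.
  rewrite redmod_cls // -(raddf0 (cls k)); apply/cls_eq; rewrite subr0.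
  by apply/unif_idealP; exists (rep B).
move=> /eqP; rewrite -(raddf0 (cls k)) clsE subr0 => /unif_idealP[y hy].
exists (cls 1 y); rewrite -[C]repK; apply/cls_eq; rewrite hy -mulrBr.
have := rep_cls 1 y; rewrite -rpredN opprB => /unif_idealP[z ->].
by apply/unif_idealP; exists z; rewrite mulrA -exprD addn1.
Qed.

Lemma card_vec_fib n k (B : 'rV[Rmod k]_n) :
  #|[pred A : 'rV[Rmod k.+1]_n | map_mx (@redmod K k.+1 k) A == B]| = (resq ^ n)%N.
Proof.
have [||||N N0 [cN fN]] := @card_fib 'rV[Rmod k.+1]_n 'rV[Rmod k]_n
  (map_mx (redmod k)) predT predT.
- by move=> x y; apply/rowP => i; rewrite !mxE redmodB.
- by [].
- move=> C; split=> // _; exists (map_mx (redmod k.+1) C) => //.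
  by apply/rowP => i; rewrite !mxE redmod_cls // repK.
- by exists 0.
have {fN} -> : #|[pred A : 'rV[Rmod k.+1]_n | map_mx (@redmod K k.+1 k) A == B]| = N.
  by rewrite -(fN B).
have : #|{: 'rV[Rmod k.+1]_n}| = (N * #|{: 'rV[Rmod k]_n}|)%N by exact: cN.
rewrite !card_mx !card_Rmod !mul1n expnS expnMn => /eqP.
by rewrite eqn_pmul2r ?expn_gt0 ?resq_gt0 // => /eqP.
Qed.

End FiniteResidues.

Section GroupAlgebra.
Variables (C : numFieldType) (K : padicField).
Local Notation Rmod k := (Rmod K k).

(* The group algebra of (R_k, +): F is the element \sum_A F A gamma^A, and
   multiplication is convolution (the pointwise ring structure of ffun is not
   inherited by the alias). *)
Definition galg (k : nat) : Type := {ffun Rmod k -> C^o}.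

HB.instance Definition _ k := Choice.on (galg k).
HB.instance Definition _ k := GRing.Lmodule.on (galg k).

Definition gcoef k (F : galg k) (A : Rmod k) : C := (F : {ffun _ -> _}) A.

Definition gam k (A : Rmod k) : galg k := [ffun B => (B == A)%:R].

Definition galg_mul k (F G : galg k) : galg k :=
  [ffun A => \sum_B gcoef F B * gcoef G (A - B)].

Lemma galgP k (F G : galg k) : (forall A, gcoef F A = gcoef G A) -> F = G.
Proof. by move=> h; apply/ffunP => A; exact: h. Qed.

Lemma gcoef_gam k (A B : Rmod k) : gcoef (gam A) B = (B == A)%:R.
Proof. by rewrite /gcoef ffunE. Qed.

Lemma gcoefD k (F G : galg k) A : gcoef (F + G) A = gcoef F A + gcoef G A.
Proof. by rewrite /gcoef ffunE. Qed.

Lemma gcoef0 k A : gcoef (0 : galg k) A = 0.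
Proof. by rewrite /gcoef ffunE. Qed.

Lemma gcoefZ k a (F : galg k) A : gcoef (a *: F) A = a * gcoef F A.
Proof. by rewrite /gcoef ffunE. Qed.

Lemma gcoef_mul k (F G : galg k) A :
  gcoef (galg_mul F G) A = \sum_B gcoef F B * gcoef G (A - B).
Proof. by rewrite {1}/gcoef ffunE. Qed.

Lemma gcoef_sum k I (r : seq I) (P : pred I) (F : I -> galg k) A :
  gcoef (\sum_(i <- r | P i) F i) A = \sum_(i <- r | P i) gcoef (F i) A.
Proof.
exact: (big_morph (fun G : galg k => gcoef G A)
  (fun G H => gcoefD G H A) (@gcoef0 k A)).
Qed.

Lemma galg_mulA k : associative (@galg_mul k).
Proof.
move=> F G H; apply: galgP => A; rewrite !gcoef_mul.
under eq_bigr do rewrite gcoef_mul big_distrr /=.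
under [RHS]eq_bigr do rewrite gcoef_mul big_distrl /=.
rewrite [RHS]exchange_big /=; apply: eq_bigr => B _.
rewrite [RHS](reindex_inj (addrI B)) /=; apply: eq_bigr => D _.
by rewrite mulrA [B + D - B]addrC addKr opprD addrA.
Qed.

Lemma galg_mulC k : commutative (@galg_mul k).
Proof.
move=> F G; apply: galgP => A; rewrite !gcoef_mul.
rewrite (reindex_inj (subrI A)) /=; apply: eq_bigr => B _.
by rewrite mulrC subKr.
Qed.

Lemma galg_mul1 k : left_id (gam 0) (@galg_mul k).
Proof.
move=> F; apply: galgP => A; rewrite gcoef_mul (bigD1 0) //= big1.
  by rewrite gcoef_gam eqxx mul1r subr0 addr0.
by move=> B /negPf B0; rewrite gcoef_gam B0 mul0r.
Qed.

Lemma galg_mulDl k : left_distributive (@galg_mul k) +%R.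
Proof.
move=> F G H; apply: galgP => A; rewrite gcoefD !gcoef_mul -big_split /=.
by apply: eq_bigr => B _; rewrite gcoefD mulrDl.
Qed.

HB.instance Definition _ k := GRing.Zmodule_isComPzRing.Build (galg k)
  (@galg_mulA k) (@galg_mulC k) (@galg_mul1 k) (@galg_mulDl k).

Lemma gcoefM k (F G : galg k) A :
  gcoef (F * G) A = \sum_B gcoef F B * gcoef G (A - B).
Proof. exact: gcoef_mul. Qed.

Lemma galgE k (F : galg k) : F = \sum_A gcoef F A *: gam A.
Proof.
apply: galgP => A; rewrite gcoef_sum (bigD1 A) //= big1 => [|B /negPf BA].
  by rewrite gcoefZ gcoef_gam eqxx mulr1 addr0.
by rewrite gcoefZ gcoef_gam eq_sym BA mulr0.
Qed.

Definition galg_red k (F : galg k.+1) : galg k :=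
  \sum_A gcoef F A *: gam (redmod k A).

Lemma galg_redD k (F G : galg k.+1) :
  galg_red (F + G) = galg_red F + galg_red G.
Proof.
 rewrite /galg_red -big_split; apply: eq_bigr => A _.
by rewrite gcoefD scalerDl.
Qed.

Lemma galg_red0 k : galg_red (0 : galg k.+1) = 0.
Proof. by rewrite /galg_red big1 // => A _; rewrite gcoef0 scale0r. Qed.

Lemma galg_redZ k a (F : galg k.+1) : galg_red (a *: F) = a *: galg_red F.
Proof.
by rewrite /galg_red scaler_sumr; apply: eq_bigr => A _; rewrite gcoefZ scalerA.
Qed.

Lemma galg_redN k (F : galg k.+1) : galg_red (- F) = - galg_red F.
Proof. by rewrite -!scaleN1r galg_redZ. Qed.

Lemma galg_red_sum k I (r : seq I) (P : pred I) (F : I -> galg k.+1) :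
  galg_red (\sum_(i <- r | P i) F i) = \sum_(i <- r | P i) galg_red (F i).
Proof. exact: (big_morph _ (@galg_redD k) (@galg_red0 k)). Qed.

Lemma galg_red_gam k (A : Rmod k.+1) : galg_red (gam A) = gam (redmod k A).
Proof.
rewrite /galg_red (bigD1 A) //= big1 => [|B /negPf BA].
  by rewrite gcoef_gam eqxx scale1r addr0.
by rewrite gcoef_gam BA scale0r.
Qed.

Lemma gamD k (A B : Rmod k) : gam (A + B) = gam A * gam B.
Proof.
apply: galgP => D; rewrite gcoefM (bigD1 A) //= big1 => [|E /negPf EA].
  by rewrite !gcoef_gam eqxx mul1r addr0 subr_eq [A + B]addrC.
by rewrite gcoef_gam EA mul0r.
Qed.

Lemma galg_scaleAl k a (F G : galg k) : a *: (F * G) = (a *: F) * G.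
Proof.
apply: galgP => A; rewrite gcoefZ !gcoefM big_distrr /=.
by apply: eq_bigr => B _; rewrite gcoefZ mulrA.
Qed.

Lemma galg_scaleAr k a (F G : galg k) : a *: (F * G) = F * (a *: G).
Proof. by rewrite mulrC galg_scaleAl mulrC. Qed.

Lemma redmodD k (A B : Rmod k.+1) : redmod k (A + B) = redmod k A + redmod k B.
Proof.
by rewrite -[A]repK -[B]repK -raddfD !redmod_cls // raddfD.
Qed.

Lemma galg_redM k (F G : galg k.+1) :
  galg_red (F * G) = galg_red F * galg_red G.
Proof.
 rewrite {1}[F]galgE mulr_suml galg_red_sum.
rewrite {2}/galg_red mulr_suml; apply: eq_bigr => A _.
rewrite -!galg_scaleAl galg_redZ; congr (_ *: _).
rewrite {1}[G]galgE mulr_sumr galg_red_sum {2}/galg_red mulr_sumr.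
apply: eq_bigr => B _; rewrite -!galg_scaleAr galg_redZ -!gamD.
by rewrite galg_red_gam redmodD.
Qed.

Lemma galg_red1 k : galg_red (1 : galg k.+1) = 1.
Proof.
rewrite galg_red_gam; congr gam.
by rewrite -(raddf0 (@cls K k.+1)) redmod_cls // raddf0.
Qed.

Record Glim := MkGlim {
  gphi : forall k, galg k;
  gphi_compat : forall k, galg_red (gphi k.+1) = gphi k
}.

HB.instance Definition _ := gen_eqMixin Glim.
HB.instance Definition _ := gen_choiceMixin Glim.

Lemma GlimP (F G : Glim) : (forall k, gphi F k = gphi G k) -> F = G.
Proof.
case: F G => [f cf] [g cg] /= fg.
have {}fg : f = g by apply: functional_extensionality_dep.
by subst g; congr MkGlim; exact: Prop_irrelevance.
Qed.

Definition Glim0 := MkGlim galg_red0.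
Definition Glim1 := MkGlim galg_red1.

Lemma Glim_opp_compat (F : Glim) k : galg_red (- gphi F k.+1) = - gphi F k.
Proof. by rewrite galg_redN gphi_compat. Qed.
Definition Glim_opp F := MkGlim (Glim_opp_compat F).

Lemma Glim_add_compat (F G : Glim) k :
  galg_red (gphi F k.+1 + gphi G k.+1) = gphi F k + gphi G k.
Proof. by rewrite galg_redD !gphi_compat. Qed.
Definition Glim_add F G := MkGlim (Glim_add_compat F G).

Lemma Glim_mul_compat (F G : Glim) k :
  galg_red (gphi F k.+1 * gphi G k.+1) = gphi F k * gphi G k.
Proof. by rewrite galg_redM !gphi_compat. Qed.
Definition Glim_mul F G := MkGlim (Glim_mul_compat F G).

Lemma Glim_addA : associative Glim_add.
Proof. by move=> F G H; apply: GlimP => k /=; rewrite addrA. Qed.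
Lemma Glim_addC : commutative Glim_add.
Proof. by move=> F G; apply: GlimP => k /=; rewrite addrC. Qed.
Lemma Glim_add0 : left_id Glim0 Glim_add.
Proof. by move=> F; apply: GlimP => k /=; rewrite add0r. Qed.
Lemma Glim_addN : left_inverse Glim0 Glim_opp Glim_add.
Proof. by move=> F; apply: GlimP => k /=; rewrite addNr. Qed.

HB.instance Definition _ := GRing.isZmodule.Build Glim
  Glim_addA Glim_addC Glim_add0 Glim_addN.

Lemma Glim_mulA : associative Glim_mul.
Proof. by move=> F G H; apply: GlimP => k /=; rewrite mulrA. Qed.
Lemma Glim_mulC : commutative Glim_mul.
Proof. by move=> F G; apply: GlimP => k /=; rewrite mulrC. Qed.
Lemma Glim_mul1 : left_id Glim1 Glim_mul.
Proof. by move=> F; apply: GlimP => k /=; rewrite mul1r. Qed.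
Lemma Glim_mulDl : left_distributive Glim_mul +%R.
Proof. by move=> F G H; apply: GlimP => k /=; rewrite mulrDl. Qed.

HB.instance Definition _ := GRing.Zmodule_isComPzRing.Build Glim
  Glim_mulA Glim_mulC Glim_mul1 Glim_mulDl.

Lemma gphiM (F G : Glim) k : gphi (F * G) k = gphi F k * gphi G k.
Proof. by []. Qed.

End GroupAlgebra.
Arguments gam C {K k} A.

Section PowerSeries.
Variable C : fieldType.

Record fps := Fps { fcoef : nat -> C }.

HB.instance Definition _ := gen_eqMixin fps.
HB.instance Definition _ := gen_choiceMixin fps.

Lemma fpsP (f g : fps) : (forall n, fcoef f n = fcoef g n) -> f = g.
Proof. by case: f g => [f] [g] /= h; congr Fps; apply: funext. Qed.

Definition fps_zero := Fps (fun=> 0).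
Definition fps_one := Fps (fun n => (n == 0)%N%:R).
Definition fps_opp f := Fps (fun n => - fcoef f n).
Definition fps_add f g := Fps (fun n => fcoef f n + fcoef g n).
Definition fps_mul f g := Fps (fun n => \sum_(i < n.+1) fcoef f i * fcoef g (n - i)).

Lemma fps_addA : associative fps_add.
Proof. by move=> f g h; apply: fpsP => n /=; rewrite addrA. Qed.
Lemma fps_addC : commutative fps_add.
Proof. by move=> f g; apply: fpsP => n /=; rewrite addrC. Qed.
Lemma fps_add0 : left_id fps_zero fps_add.
Proof. by move=> f; apply: fpsP => n /=; rewrite add0r. Qed.
Lemma fps_addN : left_inverse fps_zero fps_opp fps_add.
Proof. by move=> f; apply: fpsP => n /=; rewrite addNr. Qed.

HB.instance Definition _ := GRing.isZmodule.Build fps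
  fps_addA fps_addC fps_add0 fps_addN.

Definition fps_trunc n f : {poly C} := \poly_(i < n.+1) fcoef f i.

Lemma fps_mulE n i f g : (i <= n)%N ->
  fcoef (fps_mul f g) i = (fps_trunc n f * fps_trunc n g)`_i.
Proof.
move=> le_in; rewrite coefM; apply: eq_bigr => j _; rewrite !coef_poly.
have -> : (j < n.+1)%N by have := ltn_ord j; lia.
by have -> : (i - j < n.+1)%N by lia.
Qed.

Lemma fps_mulC : commutative fps_mul.
Proof. by move=> f g; apply: fpsP => n; rewrite !(@fps_mulE n) // mulrC. Qed.

Lemma fps_mulA : associative fps_mul.
Proof.
move=> f g h; apply: fpsP => n; rewrite !(@fps_mulE n) //.
have -> : (fps_trunc n f * fps_trunc n (fps_mul g h))`_n =
          (fps_trunc n f * (fps_trunc n g * fps_trunc n h))`_n.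
  rewrite !coefM; apply: eq_bigr => j _; congr (_ * _).
  by rewrite coef_poly (_ : (n - j < n.+1)%N) ?(@fps_mulE n) //; lia.
rewrite mulrA !coefM; apply: eq_bigr => j _; congr (_ * _).
by rewrite coef_poly ltn_ord (@fps_mulE n) // -ltnS.
Qed.

Lemma fps_mul1 : left_id fps_one fps_mul.
Proof.
move=> f; apply: fpsP => n /=; rewrite big_ord_recl /= big1 => [|i _].
  by rewrite mul1r subn0 addr0.
by rewrite mul0r.
Qed.

Lemma fps_mulDl : left_distributive fps_mul +%R.
Proof.
move=> f g h; apply: fpsP => n /=; rewrite -big_split /=.
by apply: eq_bigr => i _; rewrite mulrDl.
Qed.

Lemma fps_one_neq0 : fps_one != 0.
Proof. by apply/eqP => /(congr1 (fcoef^~ 0%N))/eqP; rewrite /= oner_eq0. Qed.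

HB.instance Definition _ := GRing.Zmodule_isComNzRing.Build fps
  fps_mulA fps_mulC fps_mul1 fps_mulDl fps_one_neq0.

Fixpoint fps_inv_seq (f : nat -> C) (n : nat) : seq C :=
  if n is m.+1 then
    let s := fps_inv_seq f m in
    rcons s (- (f 0%N)^-1 * \sum_(i < m.+1) f i.+1 * s`_(m - i))
  else [:: (f 0%N)^-1].

Definition fps_unit : pred fps := fun f => fcoef f 0 != 0.
Definition fps_inv f : fps :=
  if fps_unit f then Fps (fun n => (fps_inv_seq (fcoef f) n)`_n) else f.

Lemma size_fps_inv_seq f n : size (fps_inv_seq f n) = n.+1.
Proof. by elim: n => //= n IH; rewrite size_rcons IH. Qed.

Lemma nth_fps_inv_seq f n i : (i <= n)%N ->
  (fps_inv_seq f n)`_i = (fps_inv_seq f i)`_i.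
Proof.
elim: n => [|n IH]; first by rewrite leqn0 => /eqP->.
rewrite leq_eqVlt => /predU1P[->//|lt_in].
by rewrite /= nth_rcons size_fps_inv_seq lt_in IH.
Qed.

Lemma fps_mulVx : {in fps_unit, left_inverse 1 fps_inv *%R}.
Proof.
move=> f uf; have f0 : fcoef f 0 != 0 by exact: uf.
rewrite mulrC /fps_inv (_ : fps_unit f); last exact: uf.
apply: fpsP => -[|n]; first by rewrite /= big_ord1 divff.
rewrite [LHS]/= big_ord_recl /= subn0 nth_rcons size_fps_inv_seq ltnn eqxx.
rewrite mulrA mulrN divff // mulN1r addrC; apply/eqP; rewrite subr_eq0; apply/eqP.
apply: eq_bigr => i _; rewrite /bump /= add1n subSS.
by rewrite [in RHS]nth_fps_inv_seq // leq_subr.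
Qed.

Lemma fps_unitPl f g : g * f = 1 -> fps_unit f.
Proof.
move=> /(congr1 (fcoef^~ 0%N)); rewrite /= big_ord1 /fps_unit => h.
by apply/eqP => f0; move/eqP: h; rewrite f0 mulr0 eq_sym oner_eq0.
Qed.

Lemma fps_inv_out : {in [predC fps_unit], fps_inv =1 id}.
Proof. by move=> f; rewrite inE /= /fps_inv /in_mem /= => /negPf->. Qed.

HB.instance Definition _ := GRing.ComNzRing_hasMulInverse.Build fps
  fps_mulVx fps_unitPl fps_inv_out.

Definition fps_t : fps := Fps (fun n => (n == 1)%N%:R).

End PowerSeries.

Section QuadraticForms.

Record qform (R : comNzRingType) := QForm {
  qrank : nat;
  qmx : 'M[R]_qrank;
  qmx_sym : qmx^T = qmx
}.

Definition qeval (S : comPzRingType) n (M : 'M[S]_n) (x : 'rV[S]_n) : S :=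
  (x *m M *m x^T) 0 0.

Definition unimodular (R : comUnitRingType) (P : qform R) : bool :=
  \det (qmx P) \is a GRing.unit.

Variable R : comNzRingType.
Implicit Types P Q : qform R.

Lemma qzero_sym : (0 : 'M[R]_0)^T = 0.
Proof. exact: trmx0. Qed.
Definition qzero : qform R := QForm qzero_sym.

Lemma qscale_sym a P : (a *: qmx P)^T = a *: qmx P.
Proof. by rewrite linearZ /= qmx_sym. Qed.
Definition qscale a P : qform R := QForm (qscale_sym a P).

Lemma qsum_sym P Q : (block_mx (qmx P) 0 0 (qmx Q))^T = block_mx (qmx P) 0 0 (qmx Q).
Proof. by rewrite tr_block_mx !qmx_sym !trmx0. Qed.
Definition qsum P Q : qform R := QForm (qsum_sym P Q).

End QuadraticForms.
Arguments qzero {R}.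

Section GeneratingFunctions.
Variables (C : numFieldType) (K : padicField).
Local Notation R := (valring K).
Local Notation Rmod k := (Rmod K k).
Local Notation q := (resq K).
Local Notation galg k := (galg C K k).
Local Notation Glim := (Glim C K).
Implicit Types P : qform R.

Definition qmod P k (A : 'rV[Rmod k]_(qrank P)) : Rmod k :=
  qeval (map_mx (cls k) (qmx P)) A.

Lemma map_mx_cls_rep m n k (A : 'M[Rmod k]_(m, n)) : map_mx (cls k) (map_mx (@rep K k) A) = A.
Proof. by apply/matrixP => i j; rewrite !mxE repK. Qed.

Lemma qeval_cls n k (M : 'M[R]_n) (x : 'rV[R]_n) :
  qeval (map_mx (cls k) M) (map_mx (cls k) x) = cls k (qeval M x).
Proof. by rewrite /qeval map_trmx -!map_mxM mxE. Qed.

Lemma qmod_red P k (A : 'rV[Rmod k.+1]_(qrank P)) :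
  redmod k (qmod A) = qmod (map_mx (@redmod K k.+1 k) A).
Proof.
rewrite /qmod -[A in LHS]map_mx_cls_rep qeval_cls redmod_cls // -qeval_cls.
by congr (qeval _ _); apply/matrixP => i j; rewrite !mxE.
Qed.

Lemma galg_red_fib P k (pA : pred 'rV[Rmod k.+1]_(qrank P))
    (pB : pred 'rV[Rmod k]_(qrank P)) :
  (forall A, pA A = pB (map_mx (@redmod K k.+1 k) A)) ->
  galg_red (\sum_(A | pA A) gam C (qmod A)) =
  (q ^ qrank P)%:R *: \sum_(B | pB B) gam C (qmod B).
Proof.
move=> pAB; rewrite galg_red_sum.
rewrite (partition_big (map_mx (@redmod K k.+1 k)) pB) /=; last by move=> A; rewrite pAB.
rewrite scaler_sumr; apply: eq_bigr => B pBB.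
rewrite (eq_bigr (fun=> gam C (qmod B))) => [|A /andP[_ /eqP <-]]; last first.
  by rewrite galg_red_gam qmod_red.
rewrite sumr_const scaler_nat -(card_vec_fib B); congr (_ *+ _).
apply: eq_card => A; rewrite !inE unfold_in pAB.
by case: eqP => [->|]; rewrite ?pBB ?andbF.
Qed.

Lemma resq_neq0 e : (q ^ e)%:R != 0 :> C.
Proof. by rewrite pnatr_eq0 -lt0n expn_gt0 resq_gt0. Qed.

Lemma resq_cancel n k (F : galg k) :
  (q ^ (n * k.+1))%:R^-1 *: ((q ^ n)%:R *: F) = (q ^ (n * k))%:R^-1 *: F.
Proof.
rewrite scalerA; congr (_ *: _); rewrite mulnS expnD natrM.
by rewrite invfM mulrAC mulVf ?resq_neq0 // mul1r.
Qed.

Definition genf_phi P k : galg k :=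
  (q ^ (qrank P * k))%:R^-1 *: \sum_(A : 'rV[Rmod k]_(qrank P)) gam C (qmod A).

Lemma genf_compat P k : galg_red (genf_phi P k.+1) = genf_phi P k.
Proof.
by rewrite /genf_phi galg_redZ (@galg_red_fib P k predT predT) // resq_cancel.
Qed.

Definition genf P : Glim := MkGlim (genf_compat P).

Definition head_phiS P k : galg k.+1 :=
  (q ^ (qrank P * k.+1))%:R^-1 *:
    \sum_(A : 'rV[Rmod k.+1]_(qrank P) | map_mx (@redmod K k.+1 1) A != 0)
      gam C (qmod A).

(* phi_0 of the head is forced by compatibility with the reduction maps. *)
Definition head_phi P k : galg k :=
  match k with 0 => galg_red (head_phiS P 0) | k'.+1 => head_phiS P k' end.

Lemma head_compat P k : galg_red (head_phi P k.+1) = head_phi P k.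
Proof.
case: k => [//|k]; rewrite /= /head_phiS galg_redZ.
rewrite (@galg_red_fib P k.+1 _
  (fun B => map_mx (@redmod K k.+1 1) B != 0)) ?resq_cancel // => A.
by congr (_ != 0); apply/matrixP => i j; rewrite !mxE redmod_comp.
Qed.

Definition head P : Glim := MkGlim (head_compat P).

Definition meets (S : set R) k : pred (Rmod k) :=
  fun D => `[< exists2 a, S a & cls k a = D >].

(* Normalized by the number N of residue classes meeting S. *)
Definition zpow_phi (S : set R) k : galg k :=
  #|@meets S k|%:R^-1 *: \sum_(D | meets S D) gam C D.

Definition affine (S : set R) : Prop :=
  S !=set0 /\ forall x y z, S x -> S y -> S z -> S (x - y + z).

Lemma zpow_compat S k : affine S -> galg_red (zpow_phi S k.+1) = zpow_phi S k.
Proof.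
move=> [[s0 Ss0] Saff].
have [||||N N0 [cN fN]] := @card_fib (Rmod k.+1) (Rmod k) (redmod k)
  (@meets S k.+1) (@meets S k).
- exact/redmodB.
- move=> _ _ _ /asboolP[a Sa <-] /asboolP[b Sb <-] /asboolP[c Sc <-].
  by apply/asboolP; exists (a - b + c); [exact: Saff|rewrite raddfD raddfB].
- move=> D; split=> [/asboolP[a Sa <-]|[_ /asboolP[a Sa <-] <-]].
    by exists (cls k.+1 a); [apply/asboolP; exists a|rewrite redmod_cls].
  by apply/asboolP; exists a => //; rewrite redmod_cls.
- by exists (cls k.+1 s0); apply/asboolP; exists s0.
rewrite /zpow_phi galg_redZ galg_red_sum.
rewrite (partition_big (redmod k) (@meets S k)) /=; last first.
  move=> _ /asboolP[a Sa <-]; apply/asboolP; exists a => //.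
  by rewrite redmod_cls.
rewrite (eq_bigr (fun D => N%:R *: gam C D)) => [|D mD]; last first.
  rewrite (eq_bigr (fun=> gam C D)) => [|B /andP[_ /eqP <-]]; last first.
    by rewrite galg_red_gam.
  by rewrite sumr_const scaler_nat -(fN D mD).
rewrite -scaler_sumr scalerA; congr (_ *: _).
by rewrite cN natrM invfM mulrAC mulVf ?mul1r // pnatr_eq0 -lt0n.
Qed.

Definition coset (a : R) (j : nat) : set R := [set x | x - a \in unif_ideal j].

Lemma affine_coset a j : affine (coset a j).
Proof.
rewrite /coset; split=> [|x y z /= xa ya za].
  by exists a; rewrite /= subrr rpred0.
have -> : x - y + z - a = (x - a) - (y - a) + (z - a) by ring.
by apply: rpredD => //; apply: rpredB.
Qed.

Lemma affine1 a : affine [set a].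
Proof. by split=> [|x y z -> -> ->]; [exists a|rewrite subrr add0r]. Qed.

Definition zpow (a : R) : Glim := MkGlim (fun k => zpow_compat k (affine1 a)).
Definition zpow_coset (a : R) (j : nat) : Glim :=
  MkGlim (fun k => zpow_compat k (affine_coset a j)).

(* The sum F(1) of the coefficients of phi_k F does not depend on k. *)
Definition geval1 (F : Glim) : C := \sum_A gcoef (gphi F 0) A.

Lemma geval1E F k : geval1 F = \sum_A gcoef (gphi F k) A.
Proof.
elim: k => // k ->; rewrite -gphi_compat /galg_red.
under eq_bigr do rewrite gcoef_sum.
rewrite exchange_big /=; apply: eq_bigr => A _.
rewrite (bigD1 (redmod k A)) //= big1 => [|B /negPf BA].
  by rewrite gcoefZ gcoef_gam eqxx mulr1 addr0.
by rewrite gcoefZ gcoef_gam BA mulr0.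
Qed.

Definition vnat (s : R) : nat := if vpi s is n%:E%E then `|n|%N else 0%N.

(* s A is a well-defined class of R_k for A in R_m as soon as k <= m + v(s). *)
Definition scale_phi (F : Glim) (s : R) (m k : nat) : galg k :=
  \sum_(A : Rmod m) gcoef (gphi F m) A *: gam C (cls k (s * rep A)).

Definition gsubst_phi (F : Glim) (s : R) (k : nat) : galg k :=
  if (k%:Z%:E <= vpi s)%E then geval1 F *: gam C (cls k 0)
  else scale_phi F s (k - vnat s) k.

Lemma vpi_nat (s : R) (k : nat) : ~~ (k%:Z%:E <= vpi s)%E ->
  vpi s = (vnat s)%:Z%:E /\ (vnat s < k)%N.
Proof.
have := valP s; rewrite -[(\val s \in _)]/(0 <= vpi s)%E /vnat.
case: (vpi s) => [n| |]; rewrite ?leey // !lee_fin => n0 kn.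
by rewrite gez0_abs //; split=> //; lia.
Qed.

Lemma scale_phi_compat F s m k : s \in unif_ideal (k - m) -> (m <= k)%N ->
  galg_red (scale_phi F s m.+1 k.+1) = scale_phi F s m k.
Proof.
move=> /unif_idealP[y ->] mk; rewrite /scale_phi galg_red_sum.
under eq_bigr do rewrite galg_redZ galg_red_gam redmod_cls //.
rewrite -[gphi F m]gphi_compat.
transitivity (\sum_(A : Rmod m.+1) gcoef (gphi F m.+1) A *:
   gam C (cls k (vr_unif K ^+ (k - m) * y * rep (redmod m A)))).
  apply: eq_bigr => A _; congr (_ *: _); congr (gam C _); apply/cls_eq.
  rewrite -mulrBr; have := rep_cls m (rep A).
  rewrite -rpredN opprB => /unif_idealP[z hz]; rewrite {}hz.
  apply/unif_idealP; exists (y * z).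
  rewrite mulrACA -exprD subnK //; ring.
rewrite /galg_red; under [RHS]eq_bigr do rewrite gcoef_sum scaler_suml.
rewrite [RHS]exchange_big /=; apply: eq_bigr => A _.
rewrite [RHS](bigD1 (redmod m A)) //= [X in _ = _ + X]big1 => [|B /negPf BA].
  by rewrite gcoefZ gcoef_gam eqxx mulr1 addr0.
by rewrite gcoefZ gcoef_gam BA mulr0 scale0r.
Qed.

Lemma gsubst_compat F s k : galg_red (gsubst_phi F s k.+1) = gsubst_phi F s k.
Proof.
rewrite /gsubst_phi; have [ks|/vpi_nat[vs ks]] := boolP (k.+1%:Z%:E <= vpi s)%E.
  have -> : (k%:Z%:E <= vpi s)%E by apply: le_trans ks; rewrite lee_fin; lia.
  by rewrite galg_redZ galg_red_gam redmod_cls.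
have [ks'|/vpi_nat[_ ks']] := boolP (k%:Z%:E <= vpi s)%E; last first.
  rewrite subSn ?scale_phi_compat ?leq_subr // unif_idealE vs lee_fin; lia.
have -> : k = vnat s by move: ks'; rewrite vs lee_fin; lia.
rewrite subSnn /scale_phi (geval1E F 1) galg_red_sum scaler_suml.
apply: eq_bigr => A _; rewrite galg_redZ galg_red_gam redmod_cls //.
congr (_ *: _); congr (gam C _); apply/cls_eq; rewrite subr0 mulrC unif_idealMr //.
by rewrite unif_idealE vs lee_fin.
Qed.

Definition gsubst (F : Glim) (s : R) : Glim := MkGlim (gsubst_compat F s).

Definition Ig (F : Glim) : fps C :=
  Fps (fun k => gcoef (gphi F k) (cls k 0) - gcoef (gphi F k.+1) (cls k.+1 0)).

End GeneratingFunctions.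

Section Zeta.
Variables (T : realType) (K : padicField).
Local Notation R := (valring K).

Definition balls n : set (set 'rV[R]_n) :=
  [set B | exists (a : 'rV[R]_n) (k : nat),
     B = [set x : 'rV[R]_n | forall j, x 0 j - a 0 j \in unif_ideal k]].

(* R^n with its Borel sigma-algebra: the balls form a countable basis. *)
Definition Rvec n := g_sigma_algebraType (@balls n).

Definition haar n (mu : {measure set (Rvec n) -> \bar T}) : Prop :=
  mu setT = 1%E /\
  forall (a : 'rV[R]_n) (B : set (Rvec n)), measurable B ->
    mu [set x + a | x in (B : set 'rV[R]_n)] = mu B.

Definition igusa_zeta n (mu : {measure set (Rvec n) -> \bar T})
    (f : 'rV[R]_n -> R) : fps T[i] :=
  Fps (fun k => (fine (mu [set x | vpi (f x) = k%:Z%:E]))%:C%C).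

Implicit Types Q P : nat -> qform R.

Definition quadpoly (P : qform R) m (L : 'rV[R]_m) (c : R)
    (x : 'rV[R]_(qrank P + m)) : R :=
  qeval (qmx P) (lsubmx x) + (rsubmx x *m L^T) 0 0 + c.

(* The linear form with coefficient vector L is b x for a single
   indeterminate x; L = 0 also covers the absence of any indeterminate. *)
Definition linear_one_var m (L : 'rV[R]_m) (b : R) : Prop :=
  (L = 0 /\ b = 0) \/ exists j, L = b *: delta_mx 0 j.

Definition qtotal Q (omega : nat) : qform R :=
  \big[@qsum _/qzero]_(0 <= i < omega.+1) qscale (vr_unif K ^+ i) (Q i).

Definition qpar Q (j : nat) : qform R :=
  \big[@qsum _/qzero]_(0 <= i < j.+1 | i == j %[mod 2]) Q i.

Definition rpar Q (j : nat) : nat :=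
  (\sum_(0 <= i < j.+1 | i == j %[mod 2]) qrank (Q i))%N.

Definition qexp Q (j : nat) : nat := (resq K ^ (\sum_(0 <= i < j) rpar Q i))%N.

(* Tuples (P_0, ..., P_(2 ell)) are given by functions on nat, of which only
   the first 2 ell + 1 values are used. *)
Definition qbold Q (i : nat) : nat -> qform R := fun j =>
  match j with 0 => qpar Q i | 1 => qpar Q i.+1 | _ => Q (i + j)%N end.

Definition qpair (P0 P1 : qform R) : nat -> qform R := fun j =>
  match j with 0 => P0 | 1 => P1 | _ => qzero end.

Definition Iprod (ell : nat) P : Glim T[i] K :=
  head _ (P 0%N) *
  \prod_(1 <= j < (2 * ell).+1) gsubst (genf _ (P j)) (vr_unif K ^+ j).

Definition Ipt (ell : nat) (a : R) P : fps T[i] :=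
  Ig (zpow _ a * Iprod ell P).

Definition Icoset (ell : nat) (a : R) (mu : nat) P : fps T[i] :=
  Ig (zpow_coset _ a mu * Iprod ell P).

End Zeta.

(* Main.v *)
Require Import Defs.
From HB Require Import structures.
From mathcomp Require Import all_boot all_order all_algebra.
From mathcomp Require Import zify ring.
From mathcomp Require Import all_classical all_reals measure complex.

Set Implicit Arguments.
Unset Strict Implicit.
Unset Printing Implicit Defensive.

Import Order.TTheory GRing.Theory Num.Theory.

Local Open Scope ring_scope.

(** At each level [k], substituting [z^s] is the push-forward along
    [A |-> s A], so [F |-> F(z^s)] is a ring morphism, and with [U] the uniform
    element the factor of a linear term [b x] is [U(z^b)]. Write
      [F_i = G_{Q_(i)}(z) G_{Q_(i+1)}(z^pi) prod_{j >= 2} G_{Q_{i+j}}(z^{pi^j})].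
    Splitting off the vectors divisible by [pi] gives [G_P = H_P + q^{-r} G_P(z^{pi^2})], hence
      [F_i = H_{Q_(i)}(z) G_{Q_(i+1)}(z^pi) ... + q^{-r_(i)} F_{i+1}(z^pi)].
    If [P] is unimodular and [x] is primitive, some coordinate of the gradient
    of [P] at [x] has valuation exactly [ell], so moving [x] by [pi^{ell+1} y]
    along it makes [P] run bijectively through [P(x) + pi^{2 ell+1} R]. Thus
    [H_P] absorbs [U(z^{pi^{2 ell+1}})], and with it every factor in
    [z^{pi^j}], [j > 2 ell]. Since [Ig (F(z^pi)) = t Ig F], iterating the
    recursion gives the four formulas; they differ in how it stops. *)

(** * Substitution, augmentation and the uniform element in the group algebras *)

Section GroupAlgebraPush.
Variables (C : numFieldType) (K : padicField).
Local Notation R := (valring K).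
Local Notation Rmod k := (Rmod K k).
Local Notation galg k := (galg C K k).
Local Notation Glim := (Glim C K).
Local Notation q := (resq K).
Local Notation unif := (vr_unif K).

Lemma redmodM k j : (j <= k)%N -> {morph @redmod K k j : A B / A * B}.
Proof. by move=> jk A B; rewrite -[A]repK -[B]repK -rmorphM !redmod_cls // rmorphM. Qed.

Lemma sum_gcoef_gam k (V : lmodType C) (g : Rmod k -> V) (A : Rmod k) :
  \sum_B gcoef (gam C A) B *: g B = g A.
Proof.
rewrite (bigD1 A) //= big1 => [|B /negPf BA]; last by rewrite gcoef_gam BA scale0r.
by rewrite gcoef_gam eqxx scale1r addr0.
Qed.

(** Multiplication by [s] acts on [R_k] itself, so this push-forward needs neither the case
    distinction nor the coarser level of [gsubst_phi]. *)
Definition gpush k (s : Rmod k) (F : galg k) : galg k :=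
  \sum_A gcoef F A *: gam C (s * A).

Lemma gpush_gam k (s A : Rmod k) : gpush s (gam C A) = gam C (s * A).
Proof. exact: sum_gcoef_gam. Qed.

Lemma gpushZ k (s : Rmod k) a F : gpush s (a *: F) = a *: gpush s F.
Proof. by rewrite scaler_sumr; apply: eq_bigr => A _; rewrite gcoefZ scalerA. Qed.

Lemma gpushD k (s : Rmod k) : {morph gpush s : F G / F + G}.
Proof.
by move=> F G; rewrite -big_split; apply: eq_bigr => A _; rewrite gcoefD scalerDl.
Qed.

Lemma gpush0 k (s : Rmod k) : gpush s 0 = 0.
Proof. by rewrite /gpush big1 // => A _; rewrite gcoef0 scale0r. Qed.

Lemma gpush_sum k (s : Rmod k) I (r : seq I) (P : pred I) (F : I -> galg k) :
  gpush s (\sum_(i <- r | P i) F i) = \sum_(i <- r | P i) gpush s (F i).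
Proof. exact: (big_morph _ (gpushD s) (gpush0 s)). Qed.

Lemma gpushM k (s : Rmod k) : {morph gpush s : F G / F * G}.
Proof.
move=> F G; rewrite {1}[F]galgE mulr_suml gpush_sum {2}/gpush mulr_suml.
apply: eq_bigr => A _; rewrite -!galg_scaleAl gpushZ; congr (_ *: _).
rewrite {1}[G]galgE mulr_sumr gpush_sum {2}/gpush mulr_sumr.
apply: eq_bigr => B _; rewrite -!galg_scaleAr gpushZ -!gamD gpush_gam.
by rewrite mulrDr.
Qed.

Lemma gpush_comp k (s u : Rmod k) F : gpush s (gpush u F) = gpush (s * u) F.
Proof.
rewrite [gpush u F]/gpush gpush_sum; apply: eq_bigr => A _.
by rewrite gpushZ gpush_gam mulrA.
Qed.

(** Representatives of [A] and of its reduction differ by a multiple of [pi^m], which [s] carries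
    into [pi^k R]. *)
Lemma scale_phi_level (F : Glim) (s : R) m k : s \in unif_ideal (k - m) ->
  scale_phi F s m.+1 k = scale_phi F s m k.
Proof.
move=> /unif_idealP[y ->]; rewrite /scale_phi -[gphi F m]gphi_compat.
transitivity (\sum_(A : Rmod m.+1) gcoef (gphi F m.+1) A *:
   gam C (cls k (unif ^+ (k - m) * y * rep (redmod m A)))).
  apply: eq_bigr => A _; congr (_ *: _); congr (gam C _); apply/cls_eq.
  rewrite -mulrBr; have := rep_cls m (rep A).
  rewrite -rpredN opprB => /unif_idealP[z hz]; rewrite {}hz.
  apply: (@unif_ideal_le _ _ (k - m + m)); first by lia.
  by apply/unif_idealP; exists (y * z); rewrite exprD; ring.
rewrite /galg_red; under [RHS]eq_bigr do rewrite gcoef_sum scaler_suml.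
rewrite [RHS]exchange_big /=; apply: eq_bigr => A _.
under [RHS]eq_bigr do rewrite gcoefZ -scalerA.
by rewrite -scaler_sumr (sum_gcoef_gam (fun B => gam C (cls k (_ * rep B)))).
Qed.

Lemma scale_phi_le (F : Glim) (s : R) m n k : s \in unif_ideal (k - m) ->
  (m <= n)%N -> scale_phi F s n k = scale_phi F s m k.
Proof.
move=> sk /subnKC <-; elim: (n - m)%N => [|d IH]; first by rewrite addn0.
rewrite addnS scale_phi_level //; apply: unif_ideal_le sk; lia.
Qed.

(** [gsubst_phi] reads [F] at level [0] or [k - v(s)]; raising that level to [k] turns both branches
    into the same push-forward. *)
Lemma gphi_gsubst (F : Glim) (s : R) k :
  gphi (gsubst F s) k = gpush (cls k s) (gphi F k).
Proof.
have -> : gpush (cls k s) (gphi F k) = scale_phi F s k k.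
  by apply: eq_bigr => A _; rewrite -{2}[A]repK -rmorphM.
rewrite /= /gsubst_phi; case: ifPn => [ks|/vpi_nat[vs ks]].
  rewrite (@scale_phi_le F s 0) ?subn0 ?unif_idealE // /geval1 scaler_suml.
  apply: eq_bigr => A _; congr (_ *: _); congr (gam C _); apply/cls_eq.
  by rewrite sub0r rpredN mulrC unif_idealMr // unif_idealE.
by rewrite (@scale_phi_le F s (k - vnat s)) // ?leq_subr // unif_idealE vs lee_fin; lia.
Qed.

(** Lower levels are reductions of higher ones. This bypasses level [0], where the head is only
    defined by reduction. *)
Lemma GlimP_ge N (F G : Glim) : (forall k, (N <= k)%N -> gphi F k = gphi G k) -> F = G.
Proof.
elim: N => [|N IH] h; first by apply: GlimP => k; exact: h.
apply: IH => k; rewrite leq_eqVlt => /predU1P[<-|]; last exact: h.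
by rewrite -(gphi_compat F) -(gphi_compat G) h.
Qed.

Lemma gsubstM (s : R) : {morph (@gsubst C K)^~ s : F G / F * G}.
Proof. by move=> F G; apply: GlimP => k; rewrite gphiM !gphi_gsubst gpushM. Qed.

Lemma gsubst_comp (F : Glim) (s u : R) : gsubst (gsubst F s) u = gsubst F (u * s).
Proof. by apply: GlimP => k; rewrite !gphi_gsubst gpush_comp rmorphM. Qed.

Lemma gphi1 k : gphi (1 : Glim) k = gam C 0.
Proof. by []. Qed.

Lemma gphiD (F G : Glim) k : gphi (F + G) k = gphi F k + gphi G k.
Proof. by []. Qed.

Lemma gsubst1 (s : R) : gsubst (1 : Glim) s = 1.
Proof. by apply: GlimP => k; rewrite gphi_gsubst gphi1 gpush_gam mulr0. Qed.

Lemma gsubst_prod (s : R) I (r : seq I) (P : pred I) (F : I -> Glim) :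
  gsubst (\prod_(i <- r | P i) F i) s = \prod_(i <- r | P i) gsubst (F i) s.
Proof. exact: (big_morph _ (gsubstM s) (gsubst1 s)). Qed.

Lemma gsubst_id (F : Glim) : gsubst F 1 = F.
Proof.
apply: GlimP => k; rewrite gphi_gsubst [RHS]galgE rmorph1.
by apply: eq_bigr => A _; rewrite mul1r.
Qed.

(** The augmentation of the group algebra, a ring morphism whose value at any level is [F(1)]. *)
Definition gaug k (F : galg k) : C := \sum_A gcoef F A.

Lemma gaug_gam k (A : Rmod k) : gaug (gam C A) = 1.
Proof.
rewrite /gaug (bigD1 A) //= big1 => [|B /negPf BA]; last by rewrite gcoef_gam BA.
by rewrite gcoef_gam eqxx addr0.
Qed.

Lemma gaugZ k a (F : galg k) : gaug (a *: F) = a * gaug F.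
Proof. by rewrite mulr_sumr; apply: eq_bigr => A _; rewrite gcoefZ. Qed.

Lemma gaug_sum k I (r : seq I) (P : pred I) (F : I -> galg k) :
  gaug (\sum_(i <- r | P i) F i) = \sum_(i <- r | P i) gaug (F i).
Proof. by rewrite exchange_big /=; apply: eq_bigr => A _; rewrite gcoef_sum. Qed.

Lemma gaugM k (F G : galg k) : gaug (F * G) = gaug F * gaug G.
Proof.
rewrite {1}[F]galgE mulr_suml gaug_sum mulr_suml; apply: eq_bigr => A _.
rewrite -galg_scaleAl gaugZ; congr (_ * _).
rewrite {1}[G]galgE mulr_sumr gaug_sum; apply: eq_bigr => B _.
by rewrite -galg_scaleAr gaugZ -gamD gaug_gam mulr1.
Qed.

Lemma gaug_push k (s : Rmod k) F : gaug (gpush s F) = gaug F.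
Proof. by rewrite gaug_sum; apply: eq_bigr => A _; rewrite gaugZ gaug_gam mulr1. Qed.

Lemma geval1_aug (F : Glim) k : geval1 F = gaug (gphi F k).
Proof. exact: geval1E. Qed.

Lemma geval1M (F G : Glim) : geval1 (F * G) = geval1 F * geval1 G.
Proof. by rewrite !(geval1_aug _ 0) gphiM gaugM. Qed.

Lemma geval1_1 : geval1 (1 : Glim) = 1.
Proof. by rewrite (geval1_aug _ 0) gphi1 gaug_gam. Qed.

Lemma geval1_gsubst (F : Glim) (s : R) : geval1 (gsubst F s) = geval1 F.
Proof. by rewrite !(geval1_aug _ 0) gphi_gsubst gaug_push. Qed.

Lemma geval1_prod I (r : seq I) (P : pred I) (F : I -> Glim) :
  (forall i, geval1 (F i) = 1) -> geval1 (\prod_(i <- r | P i) F i) = 1.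
Proof.
move=> F1; apply: (big_ind (fun G => geval1 G = 1)) => //; first exact: geval1_1.
by move=> G H G1 H1; rewrite geval1M G1 H1 mulr1.
Qed.

(** A homomorphism has fibres of equal size over its image [S], so an average over [U] becomes an
    average over [S]. *)
Lemma avg_image (U V : finZmodType) (f : U -> V) (S : pred V) (W : lmodType C)
    (g : V -> W) :
  {morph f : x y / x - y} -> (forall y, S y <-> exists x, f x = y) ->
  #|{: U}|%:R^-1 *: \sum_u g (f u) = #|S|%:R^-1 *: \sum_(v | S v) g v.
Proof.
move=> fB fS; have [||||N N0 [cN fN]] := @card_fib U V f predT S => //.
- by move=> y; split=> [/fS[x <-]|[x _ <-]]; [exists x|apply/fS; exists x].
- by exists 0.
have -> : #|{: U}| = (N * #|S|)%N by exact: cN.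
rewrite (partition_big f S) /=; last by move=> u _; apply/fS; exists u.
rewrite (eq_bigr (fun v => N%:R *: g v)) => [|v Sv]; last first.
  rewrite (eq_bigr (fun=> g v)) => [|u /eqP<- //].
  by rewrite sumr_const scaler_nat -(fN v Sv).
rewrite -scaler_sumr scalerA; congr (_ *: _).
by rewrite natrM invfM mulrAC mulVf ?mul1r // pnatr_eq0 -lt0n.
Qed.

(** The coset [0 + pi^0 R] is all of [R]: this is the uniform element, the generating function of a
    free variable. *)
Definition unifg : Glim := zpow_coset C 0 0.

Lemma gphi_unifg k : gphi unifg k = #|{: Rmod k}|%:R^-1 *: \sum_A gam C A.
Proof.
have mT : Defs.meets (k := k) (coset (0 : R) 0) =1 predT.
  move=> D; apply/asboolP; exists (rep D); rewrite ?repK //.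
  exact: unif_ideal0.
by rewrite /= /zpow_phi (eq_card mT); congr (_ *: _); apply: eq_bigl.
Qed.

Lemma gphi_zpow (a : R) k : gphi (zpow C a) k = gam C (cls k a).
Proof.
have m1 : Defs.meets (k := k) [set a]%classic =1 pred1 (cls k a).
  move=> D; apply/asboolP/eqP => [[_ -> <-//]|->]; first by exists a.
by rewrite /= /zpow_phi (eq_card m1) card1 invr1 scale1r (eq_bigl _ _ m1) big_pred1_eq.
Qed.

Lemma zpow0 : zpow C (0 : R) = 1.
Proof. by apply: GlimP => k; rewrite gphi_zpow rmorph0. Qed.

Lemma gsubst_zpow (a s : R) : gsubst (zpow C a) s = zpow C (s * a).
Proof. by apply: GlimP => k; rewrite gphi_gsubst !gphi_zpow gpush_gam rmorphM. Qed.

Lemma geval1_zpow (a : R) : geval1 (zpow C a) = 1.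
Proof. by rewrite (geval1_aug _ 0) gphi_zpow gaug_gam. Qed.

Lemma card_Rmod_neq0 k : #|{: Rmod k}|%:R != 0 :> C.
Proof. by rewrite card_Rmod resq_neq0. Qed.

Lemma geval1_unifg : geval1 unifg = 1.
Proof.
rewrite (geval1_aug _ 0) gphi_unifg gaugZ gaug_sum.
under eq_bigr do rewrite gaug_gam.
by rewrite sumr_const mulVf ?card_Rmod_neq0.
Qed.

Lemma unifg_gam k (A : Rmod k) : gphi unifg k * gam C A = gphi unifg k.
Proof.
rewrite gphi_unifg -galg_scaleAl; congr (_ *: _); rewrite mulr_suml.
rewrite [RHS](reindex_inj (addIr A)); apply: eq_bigr => B _; by rewrite gamD.
Qed.

(** Translations permute [R_k], so the uniform element absorbs each [gamma^A], hence anything of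
    augmentation 1. *)
Lemma unifgM (F : Glim) : geval1 F = 1 -> unifg * F = unifg.
Proof.
move=> F1; apply: GlimP => k; rewrite gphiM [gphi F k]galgE mulr_sumr.
under eq_bigr do rewrite -galg_scaleAr unifg_gam.
by rewrite -scaler_suml -geval1E F1 scale1r.
Qed.

Lemma gsubst_unifgM (F : Glim) (s u : R) : geval1 F = 1 ->
  gsubst unifg s * gsubst F (s * u) = gsubst unifg s.
Proof. by move=> F1; rewrite -gsubst_comp -gsubstM unifgM // geval1_gsubst. Qed.

Lemma gsubst_unifg_unit (s u : R) : u \is a GRing.unit ->
  gsubst unifg (s * u) = gsubst unifg s.
Proof.
move=> uu; rewrite -gsubst_comp; congr (gsubst _ s); apply: GlimP => k.
rewrite gphi_gsubst gphi_unifg gpushZ gpush_sum; congr (_ *: _).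
under eq_bigr do rewrite gpush_gam.
rewrite [RHS](reindex_inj (h := *%R (cls k u))) //.
apply: (can_inj (g := *%R (cls k u^-1))) => A.
by rewrite mulrA -rmorphM mulVr // rmorph1 mul1r.
Qed.

(** [a + pi^j R] is the image of [R] under [x |-> a + pi^j x]. This ties [Icoset] to the factor of a
    linear term. *)
Lemma zpow_cosetE (a : R) j : zpow_coset C a j = zpow C a * gsubst unifg (unif ^+ j).
Proof.
apply: GlimP => k; rewrite gphiM gphi_zpow gphi_gsubst gphi_unifg gpushZ gpush_sum.
rewrite -galg_scaleAr mulr_sumr.
under eq_bigr do rewrite gpush_gam -gamD.
(* [S] is the coset translated back to [0], so that it is the image of a homomorphism. *)
pose S : pred (Rmod k) := fun D => Defs.meets (coset a j) (D + cls k a).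
rewrite (@avg_image _ _ _ S _ (fun D => gam C (cls k a + D))).
- rewrite /= /zpow_phi; congr (_%:R^-1 *: _); last first.
    rewrite [LHS](reindex_inj (addIr (cls k a))) /=; apply: eq_bigr => D _.
    by rewrite addrC.
  rewrite -!sum1_card (reindex_inj (addIr (cls k a))) /=.
  by apply: eq_bigl.
- by move=> A B; rewrite mulrBr.
- move=> D; split=> [/asboolP[x xa xD]|[A <-]].
    have /unif_idealP[y hy] : x - a \in unif_ideal j by [].
    exists (cls k y); rewrite -rmorphM -hy rmorphB /= xD addrK //.
  apply/asboolP; exists (unif ^+ j * rep A + a).
    by rewrite /coset /= addrK; apply/unif_idealP; exists (rep A).
  by rewrite rmorphD rmorphM /= repK.
Qed.

End GroupAlgebraPush.

(** * Generating functions and heads of quadratic forms *)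

Section QuadraticGeneratingFunctions.
Variables (C : numFieldType) (K : padicField).
Local Notation R := (valring K).
Local Notation Rmod k := (Rmod K k).
Local Notation galg k := (galg C K k).
Local Notation Glim := (Glim C K).
Local Notation q := (resq K).
Local Notation unif := (vr_unif K).
Local Notation unifg := (unifg C K).
Implicit Types P : qform R.

Lemma card_rV_Rmod n k : #|{: 'rV[Rmod k]_n}| = (q ^ (n * k))%N.
Proof. by rewrite card_mx card_Rmod mul1n -expnM mulnC. Qed.

Lemma row_mx_bij (S : Type) m n :
  bijective (fun A : 'rV[S]_m * 'rV[S]_n => row_mx A.1 A.2).
Proof.
exists (fun A => (lsubmx A, rsubmx A)) => [[A B]|A] /=; last exact: hsubmxK.
by rewrite row_mxKl row_mxKr.
Qed.

Lemma qeval_row_mx (S : comPzRingType) m n (M : 'M[S]_m) (N : 'M[S]_n) A B :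
  qeval (block_mx M 0 0 N) (row_mx A B) = qeval M A + qeval N B.
Proof.
rewrite /qeval mul_row_block !mulmx0 addr0 add0r tr_row_mx mul_row_col.
by rewrite mxE.
Qed.

Lemma qevalZ (S : comPzRingType) n (M : 'M[S]_n) a A :
  qeval M (a *: A) = a ^+ 2 * qeval M A.
Proof.
by rewrite /qeval linearZ /= -scalemxAr -scalemxAl -scalemxAl scalerA mxE.
Qed.

Lemma genf_qzero : genf C qzero = 1 :> Glim.
Proof.
apply: GlimP => k; rewrite /= /genf_phi mul0n expn0 invr1 scale1r.
rewrite (bigD1 0) //= big1 => [|A]; last by rewrite [A]thinmx0 eqxx.
by rewrite addr0 /qmod /qeval mul0mx mul0mx mxE.
Qed.

Lemma genf_qsum P P' : genf C (qsum P P') = genf C P * genf C P'.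
Proof.
apply: GlimP => k; rewrite /= /genf_phi.
rewrite (reindex _ (onW_bij _ (row_mx_bij _ _ _))) /=.
rewrite -galg_scaleAl -galg_scaleAr scalerA -invfM -natrM -expnD -mulnDl.
congr (_ *: _); rewrite mulr_suml.
under [RHS]eq_bigr do rewrite mulr_sumr.
rewrite pair_bigA /=; apply: eq_bigr => -[A B] _ /=.
rewrite -gamD; congr (gam C _); rewrite /qmod /= map_block_mx !map_mx0.
exact: qeval_row_mx.
Qed.

Lemma genf_big I (r : seq I) (p : pred I) (F : I -> qform R) :
  genf C (\big[@qsum _/qzero]_(i <- r | p i) F i) = \prod_(i <- r | p i) genf C (F i).
Proof. exact: (big_morph _ genf_qsum genf_qzero). Qed.

Lemma genf_qscale s P : genf C (qscale s P) = gsubst (genf C P) s.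
Proof.
apply: GlimP => k; rewrite gphi_gsubst /= /genf_phi gpushZ gpush_sum.
congr (_ *: _); apply: eq_bigr => A _; rewrite gpush_gam; congr (gam C _).
by rewrite /qmod /= map_mxZ /qeval -scalemxAr -scalemxAl mxE.
Qed.

Lemma geval1_genf P : geval1 (genf C P) = 1.
Proof.
rewrite (geval1_aug _ 0) /= /genf_phi gaugZ gaug_sum.
under eq_bigr do rewrite gaug_gam.
by rewrite sumr_const card_rV_Rmod mulVf ?resq_neq0.
Qed.

Lemma gcst_compat (a : C) k : galg_red (a *: (1 : galg k.+1)) = a *: (1 : galg k).
Proof. by rewrite galg_redZ galg_red1. Qed.

(** The scalar [a] as the element [a z^0], so that scaling is a product in [Glim]. *)
Definition gcst (a : C) : Glim := MkGlim (gcst_compat a).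

Lemma gphi_gcstM a (F : Glim) k : gphi (gcst a * F) k = a *: gphi F k.
Proof. by rewrite gphiM /= -galg_scaleAl mul1r. Qed.

Lemma Rmod_unif_mul k (A : Rmod k.+1) :
  redmod 1 A = 0 <-> exists B, A = cls k.+1 unif * B.
Proof.
split=> [/eqP|[B ->]]; last first.
  rewrite redmodM // redmod_cls // -[redmod 1 B]repK -rmorphM -(raddf0 (cls 1)).
  by apply/cls_eq; rewrite subr0; apply/unif_idealP; exists (rep (redmod 1 B)).
rewrite -{1}(raddf0 (cls 1)) clsE subr0 => /unif_idealP[y hy].
by exists (cls k.+1 y); rewrite -rmorphM /= -[unif]expr1 -hy repK.
Qed.

(** The vectors [pi B] have density [q^-n], with [n] the rank, and [P(pi B) = pi^2 P(B)]; the others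
    make up the head. *)
Lemma genf_head P :
  genf C P = Defs.head C P + gcst (q ^ qrank P)%:R^-1 * gsubst (genf C P) (unif ^+ 2).
Proof.
apply: (@GlimP_ge _ _ 1) => -[//|k] _.
rewrite gphiD gphi_gcstM gphi_gsubst /= /genf_phi /head_phiS.
set n := qrank P; set r1 := map_mx _.
rewrite [X in _ *: X = _](bigID (fun A : 'rV[Rmod k.+1]_n => r1 A != 0)) /= scalerDr.
congr (_ + _).
rewrite gpushZ gpush_sum.
pose S := [pred A : 'rV[Rmod k.+1]_n | r1 A == 0].
rewrite [X in _ = _ *: (_ *: X)](eq_bigr
  (fun A => gam C (@qmod K P k.+1 (cls k.+1 unif *: A)))); last first.
  by move=> A _; rewrite gpush_gam /qmod qevalZ rmorphXn.
rewrite -card_rV_Rmod (@avg_image C _ _ _ S _ (fun A => gam C (@qmod K P k.+1 A))).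
- rewrite scalerA -invfM -natrM; congr (_%:R^-1 *: _); last first.
    by apply: eq_bigl => A; rewrite negbK.
  (* Reduction mod [pi] has equal fibres, so one vector in [q ^ n] is divisible by [pi]. *)
  have [||||N N0 [cN fN]] :=
    @card_fib 'rV[Rmod k.+1]_n 'rV[Rmod 1]_n r1 predT predT => //.
  + by move=> x y; apply/rowP => i; rewrite !mxE redmodB.
  + move=> D; split=> // _; exists (map_mx (redmod k.+1) D) => //.
    by apply/rowP => i; rewrite !mxE redmod_cls // repK.
  + by exists 0.
  have -> : #|{: 'rV[Rmod k.+1]_n}| = (N * #|{: 'rV[Rmod 1]_n}|)%N by exact: cN.
  by rewrite card_rV_Rmod muln1 mulnC -(fN 0).
- by move=> A B; rewrite scalerBr.
- move=> A; split=> [/eqP A0|[B <-]].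
    have h i : exists B, A 0 i = cls k.+1 unif * B.
      by apply/Rmod_unif_mul; move/rowP/(_ i): A0; rewrite !mxE.
    exists (\row_i sval (cid (h i))); apply/rowP => i; rewrite !mxE.
    by rewrite -(svalP (cid (h i))).
  by apply/eqP/rowP => i; rewrite !mxE; apply/Rmod_unif_mul; exists (B 0 i).
Qed.

Lemma vr_unitE (x : R) : (x \is a GRing.unit) = (x \notin unif_ideal 1).
Proof.
rewrite unif_idealE -[x \is a _]/(vpi x == 0%E); have : (0 <= vpi x)%E := valP x.
by case: (vpi x) => [n| |] //; rewrite !lee_fin eqe; lia.
Qed.

Lemma Rmod_inv k (A : Rmod k.+1) : redmod 1 A != 0 -> exists B, B * A = 1.
Proof.
rewrite -(raddf0 (cls 1)) clsE subr0 -vr_unitE => uA.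
by exists (cls k.+1 (rep A)^-1); rewrite -{2}[A]repK -rmorphM mulVr // rmorph1.
Qed.

(** [redmod 1] restricted to levels at least 1, where it is a ring morphism to the residue field. *)
Definition red1 k : Rmod k.+1 -> Rmod 1 := redmod 1.

Lemma red1_is_zmod k : zmod_morphism (@red1 k).
Proof. exact: redmodB. Qed.

HB.instance Definition _ k :=
  GRing.isZmodMorphism.Build (Rmod k.+1) (Rmod 1) (@red1 k) (@red1_is_zmod k).

Lemma red1_is_monoid k : monoid_morphism (@red1 k).
Proof. by split=> [|A B]; [exact: redmod_cls|exact: redmodM]. Qed.

HB.instance Definition _ k :=
  GRing.isMonoidMorphism.Build (Rmod k.+1) (Rmod 1) (@red1 k) (@red1_is_monoid k).

Lemma red1_unif k : red1 (cls k.+1 unif) = 0.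
Proof. by apply/Rmod_unif_mul; exists 1; rewrite mulr1. Qed.

Lemma qevalDdelta (S : comPzRingType) n (M : 'M[S]_n) A s i : M^T = M ->
  qeval M (A + s *: delta_mx 0 i) =
  qeval M A + (s * (A *m M) 0 i *+ 2 + s ^+ 2 * M i i).
Proof.
move=> Msym; have trE : (A + s *: delta_mx 0 i)^T = A^T + s *: delta_mx i 0.
  by rewrite linearD linearZ /= trmx_delta.
have dMA : (delta_mx 0 i *m M *m A^T : 'M_1) 0 0 = (A *m M) 0 i.
  by rewrite -rowE -[M]Msym -tr_col -trmx_mul mxE colE mulmxA -colE mxE Msym.
have AMd : (A *m M *m delta_mx i 0 : 'M_1) 0 0 = (A *m M) 0 i by rewrite -colE mxE.
have dMd : (delta_mx 0 i *m M *m delta_mx i 0 : 'M_1) 0 0 = M i i.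
  by rewrite -rowE -colE !mxE.
have aE (X Y : 'M[S]_1) : (X + Y) 0 0 = X 0 0 + Y 0 0 by rewrite mxE.
have zE a (X : 'M[S]_1) : (a *: X) 0 0 = a * X 0 0 by rewrite mxE.
rewrite /qeval trE !(mulmxDl, mulmxDr) -!(scalemxAl, scalemxAr) !(aE, zE).
by rewrite AMd dMA dMd; ring.
Qed.

Lemma Rmod1_neq0 : 1 != 0 :> Rmod 1.
Proof. by rewrite -(raddf0 (cls 1)) clsE subr0 -vr_unitE unitr1. Qed.

(** Shifting [A] by [pi^(ell+1) y] along the [i]-th basis vector changes [P(A)] by
    [pi^(2 ell+1) (u w y + pi m y^2)], with [w = (A M)_i] and [m = M_ii]. When [w] is a unit, the
    bracket is a bijection in [y]. *)
Lemma head_unifg P ell (u : R) : u \is a GRing.unit -> 2%:R = unif ^+ ell * u ->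
  unimodular P ->
  Defs.head C P * gsubst unifg (unif ^+ (2 * ell).+1) = Defs.head C P.
Proof.
move=> uu h2 uniP; apply: (@GlimP_ge _ _ 1) => -[//|k] _.
rewrite gphiM gphi_gsubst gphi_unifg /= /head_phiS gpushZ gpush_sum.
set n := qrank P; set r1 := map_mx _; set p := cls k.+1 unif.
pose M := map_mx (cls k.+1) (qmx P); pose M1 := map_mx (cls 1) (qmx P).
have Msym : M^T = M by rewrite /M map_trmx qmx_sym.
have red1_cls x : red1 (cls k.+1 x) = cls 1 x by exact: redmod_cls.
have r1E (A : 'rV_n) : r1 A = map_mx (@red1 k) A by [].
have r1M (A : 'rV_n) : map_mx (@red1 k) (A *m M) = r1 A *m M1.
  by rewrite map_mxM; congr (_ *m _); apply/matrixP => i j; rewrite !mxE; exact: red1_cls.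
(* The direction e depends on A mod pi only, so each shift sh y is injective. *)
pose idx (B : 'rV[Rmod 1]_n) := [pick i | (B *m M1) 0 i != 0].
pose e (B : 'rV[Rmod 1]_n) : 'rV[Rmod k.+1]_n :=
  if idx B is Some i then delta_mx 0 i else 0.
pose sh y A := A + (p ^+ ell.+1 * y) *: e (r1 A).
have r1sh y A : r1 (sh y A) = r1 A.
  apply/rowP => i; rewrite !mxE -!/(red1 _) rmorphD rmorphM rmorphM rmorphXn /=.
  by rewrite red1_unif expr0n /= !mul0r addr0.
have shI y : injective (sh y).
  move=> A B AB; have := congr1 r1 AB; rewrite !r1sh => rAB.
  by move: AB; rewrite /sh rAB => /addIr.
have idxP (A : 'rV_n) : r1 A != 0 -> exists2 i, e (r1 A) = delta_mx 0 i &
    red1 ((A *m M) 0 i) != 0.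
  move=> A0; rewrite /e /idx; case: pickP => [i hi|h].
    by exists i => //; have := congr1 (fun B : 'rV_n => B 0 i) (r1M A); rewrite mxE => ->.
  (* Otherwise [A M] vanishes mod [pi], and unimodularity forces [A] to vanish there too. *)
  case/negP: A0; have AM0 : r1 A *m M1 = 0.
    by apply/rowP => i; have /negbFE/eqP-> := h i; rewrite mxE.
  have := congr1 (mulmx^~ (map_mx (cls 1) (invmx (qmx P)))) AM0.
  rewrite /= mul0mx -mulmxA -map_mxM mulmxV; last by rewrite unitmxE.
  by rewrite map_mx1 mulmx1 => ->.
pose h (w m y : Rmod k.+1) := cls k.+1 u * w * y + p * m * y ^+ 2.
(* [h w m y - h w m y' = (y - y') f], and [f] reduces to the unit [u w] mod [pi]. *)
have hI w m : red1 w != 0 -> injective (h w m).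
  move=> w0 y y' hy; have [W hW] := Rmod_inv w0.
  set f := cls k.+1 u * w + p * m * (y + y').
  have f0 : (y - y') * f = 0.
    have -> : (y - y') * f = h w m y - h w m y' by rewrite /f /h; ring.
    by rewrite hy subrr.
  have [|B hB] := @Rmod_inv k (cls k.+1 u^-1 * W * f).
    have -> : cls k.+1 u^-1 * W * f = 1 + p * (cls k.+1 u^-1 * W * m * (y + y')).
      transitivity ((cls k.+1 u^-1 * cls k.+1 u) * (W * w) +
                    p * (cls k.+1 u^-1 * W * m * (y + y'))).
        by rewrite /f; ring.
      by rewrite hW mulr1 -(rmorphM (@cls K k.+1)) mulVr // rmorph1.
    by rewrite -/(red1 _) rmorphD rmorphM /= red1_unif mul0r addr0 rmorph1 Rmod1_neq0.
  apply/eqP; rewrite -subr_eq0; apply/eqP.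
  rewrite -[LHS]mulr1 -hB.
  have -> : (y - y') * (B * (cls k.+1 u^-1 * W * f)) =
            ((y - y') * f) * (B * (cls k.+1 u^-1 * W)) by ring.
  by rewrite f0 mul0r.
have qsh y A i : e (r1 A) = delta_mx 0 i ->
    @qmod K P _ (sh y A) =
    @qmod K P _ A + cls k.+1 (unif ^+ (2 * ell).+1) * h ((A *m M) 0 i) (M i i) y.
  move=> eA; rewrite /qmod /sh eA -/M qevalDdelta //; congr (_ + _).
  rewrite -mulr_natl -(rmorph_nat (@cls K k.+1)) h2 /h rmorphM !rmorphXn /= -/p.
  have -> : (2 * ell).+1 = (ell + ell.+1)%N by lia.
  by rewrite exprD exprS; ring.
rewrite -galg_scaleAl; congr (_ *: _); rewrite -galg_scaleAr.
apply: (canLR (scalerK (card_Rmod_neq0 C K k.+1))).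
(* Summing over [y] for fixed [A] yields the uniform factor, as [h] is bijective in [y]; summing
   over [A] for fixed [y] gives back the head, as [sh y] permutes the primitive vectors. *)
transitivity (\sum_(A : 'rV_n | r1 A != 0) \sum_y gam C (@qmod K P _ (sh y A))).
  rewrite mulr_suml; apply: eq_bigr => A /idxP[i eA wA]; rewrite mulr_sumr.
  rewrite [LHS](reindex_inj (hI _ (M i i) wA)); apply: eq_bigr => y _.
  by rewrite gpush_gam -gamD (qsh y A i).
rewrite exchange_big /= scaler_nat -sumr_const.
apply: eq_bigr => y _; rewrite [RHS](reindex_inj (shI y)) /=.
by apply: eq_bigl => A; rewrite r1sh.
Qed.

End QuadraticGeneratingFunctions.

(** * Coefficients and units of formal power series *)

Section PowerSeriesTheory.
Variable C : numFieldType.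
Implicit Types f g : fps C.

Lemma fcoefD f g k : fcoef (f + g) k = fcoef f k + fcoef g k.
Proof. by []. Qed.

Lemma fcoefB f g k : fcoef (f - g) k = fcoef f k - fcoef g k.
Proof. by []. Qed.

Lemma fcoefMn f n k : fcoef (f *+ n) k = fcoef f k *+ n.
Proof. by elim: n => [|n IH]; rewrite ?mulr0n // !mulrS fcoefD IH. Qed.

Lemma fcoef1 k : fcoef (1 : fps C) k = (k == 0)%N%:R.
Proof. by []. Qed.

Lemma fps_unitE f : (f \is a GRing.unit) = (fcoef f 0 != 0).
Proof. by []. Qed.

Lemma fps_natr_unit n : (0 < n)%N -> (n%:R : fps C) \is a GRing.unit.
Proof. by move=> n0; rewrite fps_unitE fcoefMn fcoef1 pnatr_eq0 -lt0n. Qed.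

Lemma fcoef_divn f n k : (0 < n)%N -> fcoef (f / n%:R) k = fcoef f k / n%:R.
Proof.
move=> n0; have n0' : n%:R != 0 :> C by rewrite pnatr_eq0 -lt0n.
apply: (canRL (mulfK n0')).
by rewrite mulr_natr -fcoefMn -[_ *+ n]mulr_natr divrK ?fps_natr_unit.
Qed.

Lemma fcoef_tM f k : fcoef (fps_t C * f) k = if k is k'.+1 then fcoef f k' else 0.
Proof.
case: k => [|k]; first by rewrite /= big_ord1 mul0r.
rewrite [LHS]/= big_ord_recl /= mul0r add0r big_ord_recl /= mul1r subSS subn0.
by rewrite big1 ?addr0 // => i _; rewrite mul0r.
Qed.

Lemma fcoef_t k : fcoef (fps_t C) k = (k == 1)%N%:R.
Proof. by []. Qed.

Lemma natr_divM m n : (0 < m)%N -> (0 < n)%N ->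
  ((m * n)%N%:R : fps C)^-1 = m%:R^-1 * n%:R^-1.
Proof. by move=> m0 n0; rewrite natrM invrM ?fps_natr_unit // mulrC. Qed.

End PowerSeriesTheory.

(** * Solving the recurrence [X_i = A_i + x_i X_{i+1}] *)

Section LinearRecurrence.
Variables (S : comPzRingType) (X A x : nat -> S).

(** [p n] is the product of the first [n] multipliers, accumulated by unfolding the recurrence. *)
Lemma linear_rec_sum (p : nat -> S) n : p 0 = 1 ->
  (forall i, p i.+1 = p i * x i) ->
  (forall i, (i < n)%N -> X i = A i + x i * X i.+1) ->
  X 0 = \sum_(0 <= i < n) p i * A i + p n * X n.
Proof.
move=> p0 pS; elim: n => [|n IH] hX; first by rewrite big_nil p0 add0r mul1r.
rewrite IH => [|i ltin]; last by apply: hX; lia.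
by rewrite big_nat_recr //= pS hX // mulrDr addrA mulrA.
Qed.

Lemma linear_rec_periodic n : (forall i, X i = A i + x i * X i.+1) ->
  X n.+2 = X n -> X n * (1 - x n * x n.+1) = A n + x n * A n.+1.
Proof. by move=> hX per; rewrite mulrBr mulr1 {1}hX (hX n.+1) per; ring. Qed.

End LinearRecurrence.

(** * The map [Ig]: substitution of [z^pi] and the terminal terms *)

Section Igusa.
Variables (C : numFieldType) (K : padicField).
Local Notation R := (valring K).
Local Notation Rmod k := (Rmod K k).
Local Notation galg k := (galg C K k).
Local Notation Glim := (Glim C K).
Local Notation q := (resq K).
Local Notation unif := (vr_unif K).
Local Notation unifg := (unifg C K).
Local Notation gcst := (@gcst C K).

Lemma fcoef_Ig (F : Glim) k :
  fcoef (Ig F) k = gcoef (gphi F k) 0 - gcoef (gphi F k.+1) 0.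
Proof. by rewrite /= !raddf0. Qed.

Lemma IgD : {morph @Ig C K : F G / F + G}.
Proof. by move=> F G; apply: fpsP => k; rewrite fcoefD !fcoef_Ig !gphiD !gcoefD; ring. Qed.

Lemma Ig_gcst n (F : Glim) : (0 < n)%N -> Ig (gcst n%:R^-1 * F) = Ig F / n%:R.
Proof.
move=> n0; apply: fpsP => k; rewrite fcoef_divn // !fcoef_Ig !gphi_gcstM !gcoefZ.
by rewrite -mulrBr mulrC.
Qed.

Lemma Rmod0_eq (A : Rmod 0) : A = 0.
Proof. by rewrite -[A]repK -(raddf0 (cls 0)); apply/cls_eq/unif_ideal0. Qed.

Lemma gcoef_level0 (F : Glim) : gcoef (gphi F 0) 0 = geval1 F.
Proof.
rewrite /geval1 (bigD1 0) //= big1 ?addr0 // => A.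
by rewrite [A]Rmod0_eq eqxx.
Qed.

Lemma vr_unif_neq0 : unif != 0.
Proof. by rewrite -(inj_eq val_inj) /=; exact: unif_neq0. Qed.

(** [pi A] vanishes in [R_{k+1}] exactly when [A] vanishes in [R_k]. *)
Lemma gcoef_gsubst_unif (F : Glim) k :
  gcoef (gphi (gsubst F unif) k.+1) 0 = gcoef (gphi F k) 0.
Proof.
rewrite gphi_gsubst.
have -> : gpush (cls k.+1 unif) (gphi F k.+1) = scale_phi F unif k.+1 k.+1.
  by apply: eq_bigr => A _; rewrite -{2}[A]repK -rmorphM.
rewrite scale_phi_level; last first.
  by rewrite subSnn; apply/unif_idealP; exists 1; rewrite mulr1.
rewrite gcoef_sum (bigD1 0) //= big1 => [|A A0].
  rewrite gcoefZ gcoef_gam addr0 (_ : 0 == _ = true) ?mulr1 //.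
  rewrite -(raddf0 (cls k.+1)) clsE sub0r rpredN.
  have /unif_idealP[y ->] : rep (0 : Rmod k) \in unif_ideal k.
    by rewrite -[rep _]subr0 -{1}(raddf0 (cls k)) rep_cls.
  by apply/unif_idealP; exists y; rewrite mulrA -exprS.
rewrite gcoefZ gcoef_gam (_ : 0 == _ = false) ?mulr0 //; apply/negP.
rewrite -(raddf0 (cls k.+1)) clsE sub0r rpredN => /unif_idealP[y].
rewrite exprS -mulrA => /(mulfI vr_unif_neq0) hy; case/eqP: A0.
rewrite -[A]repK hy -(raddf0 (cls k)); apply/cls_eq; rewrite subr0.
by apply/unif_idealP; exists y.
Qed.

(** Valuations grow by one. The constant term vanishes because the coefficients at levels 0 and 1
    both equal [F(1)]. *)
Lemma Ig_gsubst (F : Glim) : Ig (gsubst F unif) = fps_t C * Ig F.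
Proof.
apply: fpsP => -[|k]; rewrite fcoef_tM !fcoef_Ig !gcoef_gsubst_unif //.
by rewrite !gcoef_level0 geval1_gsubst subrr.
Qed.

Lemma gcoef_unifg k : gcoef (gphi unifg k) 0 = (q ^ k)%:R^-1.
Proof.
rewrite gphi_unifg gcoefZ gcoef_sum (bigD1 0) //= big1 => [|A A0]; last first.
  by rewrite gcoef_gam eq_sym (negPf A0).
by rewrite gcoef_gam eqxx addr0 mulr1 card_Rmod.
Qed.

(** A free variable lies in [pi^k R] with probability [q^-k]. This is the source of the last term of
    formula (2). *)
Lemma Ig_unifg : Ig unifg = (1 - 1 / q%:R) / (1 - fps_t C / q%:R).
Proof.
have q0 := resq_gt0 K.
have q0' : q%:R != 0 :> C by rewrite pnatr_eq0 -lt0n.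
have u : 1 - fps_t C / q%:R \is a GRing.unit.
  by rewrite fps_unitE fcoefB fcoef_divn // fcoef1 fcoef_t mul0r subr0 oner_neq0.
apply: (canRL (mulrK u)); apply: fpsP => k.
have -> : Ig unifg * (1 - fps_t C / q%:R) = Ig unifg - fps_t C * Ig unifg / q%:R by ring.
rewrite !fcoefB !fcoef_divn // fcoef_tM fcoef1 fcoef_Ig !gcoef_unifg.
case: k => [|k]; rewrite ?fcoef_Ig ?gcoef_unifg ?expnS ?expn0 ?natrM /=.
  by field.
by field; rewrite q0' resq_neq0.
Qed.

(** All values [a + pi x] are units, so only valuation 0 occurs. This ends formulas (3) and (4). *)
Lemma Ig_zpow_unit (a : R) (F : Glim) : a \is a GRing.unit -> geval1 F = 1 ->
  Ig (zpow C a * gsubst F unif) = 1.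
Proof.
move=> ua F1; apply: fpsP => k; rewrite fcoef_Ig.
have h j : gcoef (gphi (zpow C a * gsubst F unif) j.+1) 0 = 0.
  rewrite gphiM gphi_zpow gphi_gsubst /gpush mulr_sumr gcoef_sum big1 // => A _.
  rewrite -galg_scaleAr -gamD gcoefZ gcoef_gam (_ : 0 == _ = false) ?mulr0 //.
  apply/eqP => /(congr1 (@red1 K j)); rewrite rmorph0 rmorphD rmorphM /= red1_unif.
  rewrite mul0r addr0 /red1 redmod_cls // => /esym/eqP.
  by rewrite -(raddf0 (cls 1)) clsE subr0; apply/negP; rewrite -vr_unitE.
case: k => [|k]; last by rewrite !h subrr.
by rewrite gcoef_level0 h geval1M geval1_zpow geval1_gsubst F1 mulr1 subr0.
Qed.

Lemma vpiM (x y : R) : vpi (x * y) = (vpi x + vpi y)%E.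
Proof. by rewrite /vpi val_vrM dv_valM. Qed.

Lemma vpi_unifX n : vpi (unif ^+ n) = n%:Z%:E.
Proof. by rewrite /vpi val_unifX dv_valX. Qed.

Lemma vpi_eq_nat (x : R) n : vpi x = n%:Z%:E ->
  exists2 u, u \is a GRing.unit & x = unif ^+ n * u.
Proof.
move=> xn; have : x \in unif_ideal n by rewrite unif_idealE xn.
move=> /unif_idealP[u xu]; exists u => //; rewrite -[_ \is a _]/(vpi u == 0%E).
move: xn; rewrite xu vpiM vpi_unifX; case: (vpi u) => [k| |] //.
by rewrite -EFinD => -[h]; rewrite eqe; lia.
Qed.

Lemma vr_div_unifX n (x : R) : vr_div (unif ^+ n * x) (unif ^+ n) = x.
Proof.
apply: val_inj; rewrite /vr_div val_vrM mulrAC divff ?mul1r ?valKd //.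
by rewrite val_unifX expf_neq0 // unif_neq0.
Qed.

End Igusa.

(** * The recursion for [F_i] *)

Section Recursion.
Variables (T : realType) (K : padicField) (ell : nat).
Hypothesis hell : vpi (2%:R : valring K) = ell%:Z%:E.
Variables (Q : nat -> qform (valring K)) (omega : nat).
Hypothesis Quni : forall i, unimodular (Q i).
Hypothesis Qomega : forall i, (omega < i)%N -> Q i = qzero.

Local Notation R := (valring K).
Local Notation C := (T[i]).
Local Notation Glim := (Glim C K).
Local Notation q := (resq K).
Local Notation unif := (vr_unif K).
Local Notation unifg := (unifg C K).
Local Notation gcst := (@gcst C K).
Local Notation t := (fps_t C).

(** Of [j + 1] and [j + 2] only the latter has the parity of [j]. *)
Lemma big_par (S : Type) (idx : S) (op : Monoid.law idx) (F : nat -> S) j :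
  \big[op/idx]_(0 <= i < j.+3 | i == j.+2 %[mod 2]) F i =
  op (\big[op/idx]_(0 <= i < j.+1 | i == j %[mod 2]) F i) (F j.+2).
Proof.
rewrite big_mkcond [in RHS]big_mkcond /= big_nat_recr //= big_nat_recr //=.
rewrite eqxx; have -> : (j.+1 == j.+2 %[mod 2]) = false by lia.
rewrite Monoid.mulm1; congr (op _ _).
Qed.

Lemma genf_qparE j : genf C (qpar Q j) =
  \prod_(0 <= i < j.+1 | i == j %[mod 2]) genf C (Q i).
Proof. exact: genf_big. Qed.

Lemma genf_qparSS j : genf C (qpar Q j.+2) = genf C (qpar Q j) * genf C (Q j.+2).
Proof. by rewrite !genf_qparE; exact: (big_par *%R). Qed.

Lemma genf_qpar0 : genf C (qpar Q 0) = genf C (Q 0).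
Proof. by rewrite genf_qparE big_mkcond big_nat1. Qed.

Lemma genf_qpar1 : genf C (qpar Q 1) = genf C (Q 1).
Proof. by rewrite genf_qparE big_mkcond big_nat_recr //= big_nat1 mul1r. Qed.

Lemma rparSS j : rpar Q j.+2 = (rpar Q j + qrank (Q j.+2))%N.
Proof. exact: (big_par addn). Qed.

Lemma qrank_qpar j : qrank (qpar Q j) = rpar Q j.
Proof. exact: (big_morph (@qrank R) (id1 := 0%N) (op1 := addn)). Qed.

Lemma unimodular_qpar j : unimodular (qpar Q j).
Proof.
apply: (big_ind (@unimodular R)) => // [|P P' uP uP'].
  by rewrite /unimodular det_mx00 unitr1.
by rewrite /unimodular /= det_ublock unitrM; apply/andP.
Qed.

(** The two parities exhaust the indices up to [j + 1]; hence the full rank [r] in the denominator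
    of formula (1). *)
Lemma rpar_sum j : (\sum_(0 <= i < j.+2) qrank (Q i) = rpar Q j + rpar Q j.+1)%N.
Proof.
elim: j => [|j IH].
  have -> : rpar Q 0 = qrank (Q 0) by rewrite /rpar big_mkcond big_nat1.
  have -> : rpar Q 1 = qrank (Q 1).
    by rewrite /rpar big_mkcond big_nat_recr //= big_nat1 add0n.
  by rewrite big_nat_recr //= big_nat1.
by rewrite big_nat_recr //= IH rparSS; lia.
Qed.

Lemma qexpS j : qexp Q j.+1 = (qexp Q j * q ^ rpar Q j)%N.
Proof. by rewrite /qexp big_nat_recr //= expnD. Qed.

Lemma qexp_gt0 j : (0 < qexp Q j)%N.
Proof. by rewrite expn_gt0 resq_gt0. Qed.

Lemma t_qexpS j : t ^+ j.+1 / (qexp Q j.+1)%:R =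
  t ^+ j / (qexp Q j)%:R * (t / (q ^ rpar Q j)%:R).
Proof.
by rewrite qexpS natr_divM ?qexp_gt0 ?expn_gt0 ?resq_gt0 // exprSr mulrACA.
Qed.

(** The head contains the uniform factor in [z^{pi^(2 ell+1)}], and that factor absorbs [F(z^s)]. *)
Lemma head_absorb P (F : Glim) s : unimodular P -> geval1 F = 1 ->
  s \in unif_ideal (2 * ell).+1 -> Defs.head C P * gsubst F s = Defs.head C P.
Proof.
move=> uP F1 /unif_idealP[w ->]; have [u uu h2] := vpi_eq_nat hell.
by rewrite -(head_unifg C uu h2 uP) -mulrA gsubst_unifgM.
Qed.

Lemma Iprod_absorb i (F : Glim) s : geval1 F = 1 -> s \in unif_ideal (2 * ell).+1 ->
  Iprod T ell (qbold Q i) * gsubst F s = Iprod T ell (qbold Q i).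
Proof. by move=> F1 hs; rewrite /Iprod mulrAC head_absorb // unimodular_qpar. Qed.

(* The bound omega + 2 ell + 3 is large enough for every further factor to be 1. *)
Definition tailg i : Glim :=
  \prod_(1 <= j < (omega + 2 * ell).+3) gsubst (genf C (qbold Q i j)) (unif ^+ j).

(** This is [F_i], the generating function of the direct sum of [Q_(i)], [pi Q_(i+1)],
    [pi^2 Q_{i+2}] and so on. *)
Definition stepg i : Glim := genf C (qpar Q i) * tailg i.

Lemma geval1_stepg i : geval1 (stepg i) = 1.
Proof.
rewrite geval1M geval1_genf mul1r geval1_prod // => j.
by rewrite geval1_gsubst geval1_genf.
Qed.

(** The head absorbs the factors with [j > 2 ell], which cuts the product off where [Iprod] ends. *)
Lemma head_tailg i :
  Defs.head C (qpar Q i) * tailg i = Iprod T ell (qbold Q i).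
Proof.
rewrite /tailg (@big_cat_nat _ _ _ (2 * ell).+1) //=; last by lia.
rewrite mulrA -/(Iprod T ell (qbold Q i)).
rewrite big_nat_cond; apply: (big_rec (fun G => Iprod T ell (qbold Q i) * G = _)).
  by rewrite mulr1.
move=> j G /andP[/andP[lj _] _] IH; rewrite mulrA Iprod_absorb ?geval1_genf //.
by apply: (unif_ideal_le lj); apply/unif_idealP; exists 1; rewrite mulr1.
Qed.

(** Splitting off the head moves the factor of [Q_(i)] to [z^{pi^2}], where it joins that of
    [Q_{i+2}] to form that of [Q_(i+2)]; everything left is then a series in [z^pi]. *)
Lemma stepgE i : stepg i = Iprod T ell (qbold Q i) +
  gcst (q ^ rpar Q i)%:R^-1 * gsubst (stepg i.+1) unif.
Proof.
rewrite {1}/stepg genf_head mulrDl head_tailg qrank_qpar -mulrA; congr (_ + _ * _).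
rewrite /stepg /tailg gsubstM gsubst_prod.
under [in RHS]eq_bigr do rewrite gsubst_comp -exprS.
rewrite big_ltn // [in RHS]big_ltn // /= genf_qparSS !gsubstM expr1.
rewrite -!mulrA mulrCA; congr (_ * (_ * _)).
rewrite big_ltn //= addn2; congr (_ * _).
(* The last factor of [tailg] at [i + 1] has index beyond [omega] and equals 1, which makes up for
   the index shift. *)
rewrite [RHS]big_nat_recr //= (Qomega (i := i.+1 + _)); last by lia.
rewrite genf_qzero gsubst1 mulr1 big_add1 /=.
rewrite big_nat_cond [RHS]big_nat_cond; apply: eq_bigr => j /andP[/andP[j2 _] _].
by case: j j2 => [|[|j]] // _; rewrite addnS -addSn.
Qed.

Lemma genf_qtotal : genf C (qtotal Q omega) = stepg 0.
Proof.
rewrite genf_big /stepg /tailg.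
rewrite big_ltn // genf_qscale; congr (_ * _).
  by rewrite gsubst_id genf_qpar0.
rewrite [RHS](@big_cat_nat _ _ _ omega.+1) //=; last by lia.
rewrite [X in _ = _ * X]big_nat_cond [X in _ = _ * X]big1 ?mulr1.
  rewrite big_nat_cond [RHS]big_nat_cond; apply: eq_bigr => -[|[|j]] // _.
    by rewrite genf_qscale genf_qpar1.
  by rewrite genf_qscale.
move=> -[|[|j]] // /andP[/andP[hj _] _].
  by rewrite genf_qpar1 Qomega // genf_qzero gsubst1.
by rewrite /= add0n Qomega // genf_qzero gsubst1.
Qed.

(** [V] carries the linear and constant parts; the step strips a factor [pi] from them too, and [Ig]
    turns the substitution into [t]. *)
Lemma Ig_stepg (V V' : Glim) i : V = gsubst V' unif ->
  Ig (V * stepg i) = Ig (V * Iprod T ell (qbold Q i)) +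
    t / (q ^ rpar Q i)%:R * Ig (V' * stepg i.+1).
Proof.
move=> VV'; rewrite {1}stepgE mulrDr IgD; congr (_ + _).
rewrite mulrCA Ig_gcst ?expn_gt0 ?resq_gt0 // VV' -gsubstM Ig_gsubst.
by rewrite mulrAC.
Qed.

(** [V i] stands for the factor of [(L + c) / pi^i], and [n] is the stopping point chosen in each
    case. *)
Lemma Ig_iter (V : nat -> Glim) n :
  (forall i, (i < n)%N -> V i = gsubst (V i.+1) unif) ->
  Ig (V 0 * stepg 0) =
  \sum_(0 <= i < n) t ^+ i / (qexp Q i)%:R * Ig (V i * Iprod T ell (qbold Q i))
  + t ^+ n / (qexp Q n)%:R * Ig (V n * stepg n).
Proof.
move=> hV; apply: (@linear_rec_sum _ (fun i => Ig (V i * stepg i))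
  (fun i => Ig (V i * Iprod T ell (qbold Q i))) (fun i => t / (q ^ rpar Q i)%:R)
  (fun i => t ^+ i / (qexp Q i)%:R)) => [|i|i ltin].
- by rewrite expr0 /qexp big_nil expn0 invr1 mul1r.
- exact: t_qexpS.
- exact: (Ig_stepg i (hV i ltin)).
Qed.

End Recursion.

(** * Haar measure, and the zeta function as a value of [Ig] *)

Section HaarMeasure.
Variables (T : realType) (K : padicField) (n : nat).
Local Notation R := (valring K).
Local Notation Rmod k := (Rmod K k).
Local Notation q := (resq K).
Variable mu : {measure set (Rvec K n) -> \bar T}.
Hypothesis hmu : haar mu.
Local Open Scope classical_set_scope.

Definition vcls k (x : 'rV[R]_n) : 'rV[Rmod k]_n := map_mx (cls k) x.

Definition vfib k (A : 'rV[Rmod k]_n) : set (Rvec K n) := [set x | vcls k x = A].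

Lemma vfibE k (a : 'rV[R]_n) :
  vfib (vcls k a) = [set x : 'rV[R]_n | forall j, x 0 j - a 0 j \in unif_ideal k].
Proof.
apply/seteqP; split=> x /= h => [j|].
  by rewrite -clsE; apply/eqP; move/rowP/(_ j): h; rewrite !mxE.
by apply/rowP => j; rewrite !mxE; apply/cls_eq.
Qed.

Lemma vcls_rep k (A : 'rV[Rmod k]_n) : vcls k (map_mx (@rep K k) A) = A.
Proof. exact: map_mx_cls_rep. Qed.

Lemma measurable_vfib k (A : 'rV[Rmod k]_n) : measurable (vfib A).
Proof.
apply: sub_sigma_algebra; rewrite -[A]vcls_rep vfibE.
by exists (map_mx (@rep K k) A), k.
Qed.

Lemma mu_vfib0 k (A : 'rV[Rmod k]_n) : mu (vfib A) = mu (vfib (0 : 'rV[Rmod k]_n)).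
Proof.
have [_ inv] := hmu; rewrite -[RHS](inv (map_mx (@rep K k) A)); last exact: measurable_vfib.
congr (mu _); apply/seteqP; split=> [x xA|_ [x /= x0 <-]].
  exists (x - map_mx (@rep K k) A); last by rewrite subrK.
  by rewrite /vfib /= /vcls map_mxB map_mx_cls_rep -/(vcls k x) xA subrr.
by rewrite /vfib /= /vcls map_mxD map_mx_cls_rep -/(vcls k x) x0 add0r.
Qed.

Lemma bigcup_vfib k (p : pred 'rV[Rmod k]_n) :
  [set x : Rvec K n | p (vcls k x)] = \bigcup_(A in [set` p]) vfib A.
Proof.
apply/seteqP; split=> [x px|x [A pA xA]]; first by exists (vcls k x).
by rewrite /= xA.
Qed.

Lemma measurable_vpred k (p : pred 'rV[Rmod k]_n) :
  measurable [set x : Rvec K n | p (vcls k x)].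
Proof.
rewrite bigcup_vfib; apply: fin_bigcup_measurable; first exact: finite_finset.
by move=> A _; exact: measurable_vfib.
Qed.

Lemma mu_vpred_sum k (p : pred 'rV[Rmod k]_n) :
  mu [set x | p (vcls k x)] = (\sum_(A | p A) mu (vfib A))%E.
Proof.
rewrite bigcup_vfib measure_fin_bigcup; first last.
- by move=> A _; exact: measurable_vfib.
- by move=> A B _ _ [x [<- <-]].
- exact: finite_finset.
by rewrite -(bigfs _ (r := index_enum _)) ?index_enum_uniq // => A _; rewrite mem_index_enum.
Qed.

(** The [q^(n k)] fibres of reduction mod [pi^k] are translates of one another and partition a space
    of measure 1. *)
Lemma mu_vpred k (p : pred 'rV[Rmod k]_n) :
  mu [set x | p (vcls k x)] = (#|p|%:R / (q ^ (n * k))%:R)%:E.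
Proof.
have [mu1 _] := hmu; have q0 : (q ^ (n * k))%:R != 0 :> T by rewrite resq_neq0.
have hT : [set x : Rvec K n | predT (vcls k x)] = setT by apply/seteqP.
have fin : mu (vfib (0 : 'rV[Rmod k]_n)) \is a fin_num.
  rewrite ge0_fin_numE //; apply: (@le_lt_trans _ _ (mu setT)).
    by apply: le_measure; rewrite ?inE //; exact: measurable_vfib.
  by rewrite mu1 ltry.
have sumE (p' : pred 'rV[Rmod k]_n) :
    mu [set x | p' (vcls k x)] = (#|p'|%:R * fine (mu (vfib (0 : 'rV[Rmod k]_n))))%:E.
  rewrite mu_vpred_sum (eq_bigr (fun=> (fine (mu (vfib (0 : 'rV[Rmod k]_n))))%:E)).
    by rewrite sumEFin sumr_const mulr_natl.
  by move=> A _; rewrite mu_vfib0 fineK.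
rewrite sumE; congr (_ * _)%:E; apply: (mulfI q0).
(* The full predicate determines the common measure of the fibres. *)
rewrite mulfV //; apply: EFin_inj; rewrite -[RHS]mu1 -hT sumE; congr (_%:R * _)%:E.
by rewrite -card_rV_Rmod.
Qed.

(** The set where [v(f) = k] is the difference of those where [pi^k] and [pi^(k+1)] divide [f];
    their volumes are the coefficients of [gamma^0] at levels [k] and [k + 1]. *)
Lemma igusa_zeta_Ig (f : 'rV[R]_n -> R) (fk : forall k, 'rV[Rmod k]_n -> Rmod k)
    (F : Glim T[i] K) :
  (forall k x, cls k (f x) = fk k (vcls k x)) ->
  (forall k, gphi F k = (q ^ (n * k))%:R^-1 *: \sum_A gam T[i] (fk k A)) ->
  igusa_zeta mu f = Ig F.
Proof.
move=> hf hF; pose p k : pred 'rV[Rmod k]_n := fun A => fk k A == 0.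
have pE k : [set x : Rvec K n | f x \in unif_ideal k] = [set x | p k (vcls k x)].
  by apply/seteqP; split=> x /=; rewrite /p -hf -(raddf0 (cls k)) clsE subr0.
have gE k : gcoef (gphi F k) 0 = (#|p k|%:R / (q ^ (n * k))%:R)%:C%C.
  rewrite hF gcoefZ gcoef_sum mulrC rmorphM rmorphV ?unitfE ?resq_neq0 //.
  rewrite !rmorph_nat; congr (_ / _); rewrite -sum1_card natr_sum [RHS]big_mkcond /=.
  by apply: eq_bigr => A _; rewrite gcoef_gam eq_sym -[A \in _]/(fk k A == 0); case: eqP.
apply: fpsP => k; rewrite fcoef_Ig !gE -rmorphB [LHS]/=; congr (_%:C)%C.
have -> : [set x : Rvec K n | vpi (f x) = k%:Z%:E] =
    [set x | p k (vcls k x)] `\` [set x | p k.+1 (vcls k.+1 x)].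
  rewrite -!pE; apply/seteqP; split=> x /=; rewrite !unif_idealE.
    by move=> ->; split=> //; rewrite lee_fin; lia.
  case: (vpi (f x)) => [m| |] [].
  - by rewrite !lee_fin => h1 h2; congr EFin; lia.
  - by rewrite leey => _ [].
  - by [].
set A := [set x : Rvec K n | p k _]; set B := [set x : Rvec K n | p k.+1 _].
have AB : A `&` B = B by rewrite /A /B -!pE setIidr // => x /=; apply: unif_ideal_le.
have -> : mu (A `\` B) = (mu A - mu B)%E.
  have muA : (mu A < +oo)%E by rewrite mu_vpred ltry.
  by rewrite -{2}AB; apply: measureD muA; exact: measurable_vpred.
by rewrite !mu_vpred.
Qed.

End HaarMeasure.

(** * The generating function of [Q] with its linear and constant terms *)

Section QuadraticPolynomials.
Variables (C : numFieldType) (K : padicField).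
Local Notation R := (valring K).
Local Notation Rmod k := (Rmod K k).
Local Notation q := (resq K).

Definition quadpoly_mod (P : qform R) m (L : 'rV[R]_m) (c : R) k
    (A : 'rV[Rmod k]_(qrank P + m)) : Rmod k :=
  qmod (lsubmx A) + (rsubmx A *m map_mx (cls k) L^T) 0 0 + cls k c.

Lemma quadpoly_cls (P : qform R) m (L : 'rV[R]_m) c k x :
  cls k (quadpoly (P := P) L c x) = quadpoly_mod L c (vcls k x).
Proof.
rewrite /quadpoly /quadpoly_mod !raddfD /= -qeval_cls /qmod /vcls.
rewrite map_lsubmx; congr (_ + _ + _).
by rewrite -map_rsubmx -map_mxM [RHS]mxE.
Qed.

(** The indeterminates that do not occur average out, leaving [b x] with [x] uniform; for [b = 0]
    both sides are [gamma^0]. *)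
Lemma avg_linear_one_var m (L : 'rV[R]_m) b k : linear_one_var L b ->
  (q ^ (m * k))%:R^-1 *: \sum_(A : 'rV[Rmod k]_m) gam C ((A *m map_mx (cls k) L^T) 0 0)
  = gphi (gsubst (unifg C K) b) k.
Proof.
rewrite -card_rV_Rmod gphi_gsubst gphi_unifg gpushZ gpush_sum.
under [in RHS]eq_bigr do rewrite gpush_gam.
case=> [[-> ->]|[j ->]].
  rewrite (eq_bigr (fun=> gam C 0)) => [|A _]; last by rewrite trmx0 map_mx0 mulmx0 mxE.
  rewrite [in RHS](eq_bigr (fun=> gam C 0)) => [|A _]; last by rewrite raddf0 mul0r.
  rewrite !sumr_const -!scaler_nat !scalerA !mulVf ?card_Rmod_neq0 //.
  by rewrite card_rV_Rmod resq_neq0.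
rewrite (eq_bigr (fun A : 'rV_m => gam C (cls k b * A 0 j))) => [|A _]; last first.
  by rewrite linearZ /= trmx_delta map_mxZ map_delta_mx -scalemxAr -colE !mxE.
rewrite (@avg_image C 'rV[Rmod k]_m (Rmod k) (fun A => A 0 j) predT _
   (fun B => gam C (cls k b * B))) //.
- by move=> A B; rewrite !mxE.
- move=> B; split=> // _; exists (const_mx B); by rewrite mxE.
Qed.

Lemma gphi_quadpoly (P : qform R) m (L : 'rV[R]_m) b c k : linear_one_var L b ->
  gphi (zpow C c * gsubst (unifg C K) b * genf C P) k =
  (q ^ ((qrank P + m) * k))%:R^-1 *: \sum_A gam C (quadpoly_mod (P := P) L c A).
Proof.
move=> hL; rewrite !gphiM gphi_zpow -(avg_linear_one_var k hL) /= /genf_phi.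
rewrite [in RHS](reindex _ (onW_bij _ (row_mx_bij _ _ _))) /=.
rewrite -!galg_scaleAr -galg_scaleAl scalerA -invfM -natrM -expnD -mulnDl.
congr (_ *: _); rewrite -mulrA [X in _ * X]mulrC big_distrlr.
rewrite pair_bigA mulr_sumr; apply: eq_bigr => -[A B] _ /=.
by rewrite -!gamD /quadpoly_mod row_mxKl row_mxKr addrC.
Qed.

End QuadraticPolynomials.

(** * Stopping the recursion *)

Section Cases.
Variables (T : realType) (K : padicField) (ell : nat).
Hypothesis hell : vpi (2%:R : valring K) = ell%:Z%:E.
Variables (Q : nat -> qform (valring K)) (omega : nat).
Hypothesis Quni : forall i, unimodular (Q i).
Hypothesis Qomega : forall i, (omega < i)%N -> Q i = qzero.

Local Notation R := (valring K).
Local Notation C := (T[i]).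
Local Notation q := (resq K).
Local Notation unif := (vr_unif K).
Local Notation unifg := (unifg C K).
Local Notation t := (fps_t C).
Local Notation stepQ := (stepg T ell Q omega).
Local Notation Iprodi i := (Iprod T ell (qbold Q i)).

Lemma gsubst_by0 (F : Glim C K) : geval1 F = 1 -> gsubst F 0 = 1.
Proof.
move=> F1; apply: GlimP => k; rewrite gphi_gsubst /gpush raddf0.
under eq_bigr do rewrite mul0r.
by rewrite -scaler_suml -geval1E F1 scale1r.
Qed.

Lemma unifXE m n : (m <= n)%N -> unif ^+ n \in unif_ideal m.
Proof.
by move=> mn; apply/unif_idealP; exists (unif ^+ (n - m)); rewrite -exprD subnKC.
Qed.

Lemma genf_qpar_omega j : (omega <= j.+1)%N -> genf C (qpar Q j.+2) = genf C (qpar Q j).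
Proof. by move=> h; rewrite genf_qparSS Qomega // genf_qzero mulr1. Qed.

Lemma tailg_omega i : (omega <= i.+1)%N ->
  tailg T ell Q omega i = gsubst (genf C (qpar Q i.+1)) unif.
Proof.
move=> h; rewrite /tailg big_ltn // big_nat_cond big1 ?mulr1 ?expr1 // => -[|[|j]] //.
by move=> _; rewrite /= Qomega ?genf_qzero ?gsubst1 //; lia.
Qed.

(** From [omega - 1] on no nonzero summand enters, and the generating functions of the [Q_(i)]
    merely alternate. *)
Lemma stepg_omega i : (omega <= i.+1)%N -> stepQ i.+2 = stepQ i.
Proof.
by move=> h; rewrite /stepg !tailg_omega ?genf_qpar_omega //; lia.
Qed.

(** Only the generating function of [P] enters: formula (1) has [Q_(omega-1)] where the recursion
    yields [Q_(omega+1)], and these differ by a summand of rank 0. *)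
Lemma Iprod_qpair i (P : qform R) : (omega <= i.+1)%N ->
  genf C P = genf C (qpar Q i.+1) -> Iprod T ell (qpair (qpar Q i) P) = Iprodi i.
Proof.
move=> h hP; congr (_ * _); rewrite big_nat_cond [RHS]big_nat_cond.
apply: eq_bigr => -[|[|j]] // _ /=; first by rewrite hP.
by rewrite Qomega //; lia.
Qed.

Lemma Ig_periodic w : omega = w.+1 ->
  let r := (\sum_(0 <= i < w.+2) qrank (Q i))%N in
  Ig (stepQ w) = (Ig (Iprodi w) + t / (q ^ rpar Q w)%:R * Ig (Iprodi w.+1))
                 * (1 - t ^+ 2 / (q ^ r)%:R)^-1.
Proof.
move=> hw r; have q0 e : (0 < q ^ e)%N by rewrite expn_gt0 resq_gt0.
have u : 1 - t ^+ 2 / (q ^ r)%:R \is a GRing.unit.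
  by rewrite fps_unitE fcoefB fcoef_divn // expr2 fcoef_tM mul0r subr0 oner_neq0.
apply: (canRL (mulrK u)); rewrite /r rpar_sum expnD natr_divM //.
rewrite expr2 mulrACA.
apply: (@linear_rec_periodic _ (fun i => Ig (stepQ i)) (fun i => Ig (Iprodi i))
  (fun i => t / (q ^ rpar Q i)%:R)) => [i|]; last by rewrite stepg_omega ?hw.
by rewrite {1}(stepgE T hell Quni Qomega) IgD Ig_gcst // Ig_gsubst mulrAC.
Qed.

(** On vectors divisible by [pi] the value is [a] plus a multiple of [pi], so this branch stops with
    [Ig] equal to 1. *)
Lemma Ig_stepg_unit (a : R) (F : Glim C K) i : a \is a GRing.unit -> geval1 F = 1 ->
  let V := zpow C a * gsubst F unif in
  Ig (V * stepQ i) = Ig (V * Iprodi i) + 1 / (q ^ rpar Q i)%:R.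
Proof.
move=> ua F1 V; rewrite (stepgE T hell Quni Qomega) mulrDr IgD; congr (_ + _).
rewrite mulrCA Ig_gcst ?expn_gt0 ?resq_gt0 // -mulrA -gsubstM Ig_zpow_unit //.
by rewrite geval1M F1 geval1_stepg mulr1.
Qed.

(** [beta i] stands for [b / pi^i] up to a unit, and [pi] dividing [beta kappa] says [v(b) > v(c)].
    Formulas (3) and (4) are thus one computation until the uniform factor is absorbed. *)
Lemma Ig_iter_unit (u : R) kappa (beta : nat -> R) : u \is a GRing.unit ->
  (forall i, (i < kappa)%N -> beta i = unif * beta i.+1) ->
  beta kappa \in unif_ideal 1 ->
  let c := unif ^+ kappa * u in
  Ig (zpow C c * gsubst unifg (beta 0) * stepQ 0) =
  \sum_(0 <= i < kappa.+1) t ^+ i / (qexp Q i)%:R *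
     Ig (zpow C (vr_div c (unif ^+ i)) * gsubst unifg (beta i) * Iprodi i)
  + t ^+ kappa / (qexp Q kappa.+1)%:R.
Proof.
move=> uu hbeta /unif_idealP[w hw] c.
have cE i : (i <= kappa)%N -> vr_div c (unif ^+ i) = unif ^+ (kappa - i) * u.
  by move=> ik; rewrite /c -(subnKC ik) exprD -mulrA vr_div_unifX subnKC.
pose V i := zpow C (vr_div c (unif ^+ i)) * gsubst unifg (beta i).
have -> : zpow C c * gsubst unifg (beta 0) = V 0%N by rewrite /V cE // subn0.
rewrite (Ig_iter hell Quni Qomega (n := kappa)) => [|i ik]; last first.
  rewrite /V gsubstM gsubst_zpow gsubst_comp hbeta // !cE //; last by lia.
  by rewrite mulrA -exprS subnSK.
rewrite [in RHS]big_nat_recr //= -addrA; congr (_ + _).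
have VE : V kappa = zpow C u * gsubst (gsubst unifg w) unif.
  by rewrite /V cE // subnn expr0 mul1r hw expr1 gsubst_comp.
rewrite -/(V kappa) VE Ig_stepg_unit ?geval1_gsubst ?geval1_unifg // mulrDr.
by congr (_ + _); rewrite qexpS natr_divM ?qexp_gt0 ?expn_gt0 ?resq_gt0 // mul1r mulrA.
Qed.

End Cases.

(** * Assembly of the four formulas *)

Theorem theorem4p5 (T : realType) (K : padicField) (ell : nat)
    (hell : vpi (2%:R : valring K) = ell%:Z%:E)
    (Q : nat -> qform (valring K)) (omega : nat)
    (Quni : forall i, unimodular (Q i))
    (omega_gt0 : (0 < omega)%N)
    (Qomega : forall i, (omega < i)%N -> Q i = qzero)
    (m : nat) (L : 'rV[valring K]_m) (b c : valring K)
    (hL : linear_one_var L b)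
    (mu : {measure set (Rvec K (qrank (qtotal Q omega) + m)) -> \bar T})
    (hmu : haar mu) :
  let q : nat := resq K in
  let t : fps T[i] := fps_t T[i] in
  let r : nat := (\sum_(0 <= i < omega.+1) qrank (Q i))%N in
  let cdiv (i : nat) : valring K := vr_div c (vr_unif K ^+ i) in
  let Z : fps T[i] := igusa_zeta mu (quadpoly (P := qtotal Q omega) L c) in
  [/\ L = 0 -> c = 0 ->
      Z = \sum_(0 <= i < omega.-1)
            t ^+ i / (qexp Q i)%:R * Ipt T ell 0 (qbold Q i)
        + (t ^+ omega.-1 / (qexp Q omega.-1)%:R
             * Ipt T ell 0 (qpair (qpar Q omega.-1) (qpar Q omega))
           + t ^+ omega / (qexp Q omega)%:R
             * Ipt T ell 0 (qpair (qpar Q omega) (qpar Q omega.-1)))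
          * (1 - t ^+ 2 / (q ^ r)%:R)^-1,
      forall lambda : nat,
      vpi b = lambda%:Z%:E -> (vpi b <= vpi c)%E ->
      Z = \sum_(0 <= i < lambda - 2 * ell)
            t ^+ i / (qexp Q i)%:R * Ipt T ell 0 (qbold Q i)
        + \sum_(maxn 0 (lambda - 2 * ell) <= i < lambda)
            t ^+ i / (qexp Q i)%:R * Icoset T ell 0 (lambda - i) (qbold Q i)
        + t ^+ lambda / (qexp Q lambda)%:R
            * ((1 - 1 / q%:R) / (1 - t / q%:R)),
      forall lambda kappa : nat,
      vpi b = lambda%:Z%:E -> vpi c = kappa%:Z%:E ->
      (vpi c < vpi b)%E -> (vpi b <= vpi c + (2 * ell)%:Z%:E)%E ->
      Z = \sum_(0 <= i < lambda - 2 * ell)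
            t ^+ i / (qexp Q i)%:R * Ipt T ell (cdiv i) (qbold Q i)
        + \sum_(maxn 0 (lambda - 2 * ell) <= i < kappa.+1)
            t ^+ i / (qexp Q i)%:R
            * Icoset T ell (cdiv i) (lambda - i) (qbold Q i)
        + t ^+ kappa / (qexp Q kappa.+1)%:R
    & forall kappa : nat,
      vpi c = kappa%:Z%:E -> (vpi c + (2 * ell)%:Z%:E < vpi b)%E ->
      Z = \sum_(0 <= i < kappa.+1)
            t ^+ i / (qexp Q i)%:R * Ipt T ell (cdiv i) (qbold Q i)
        + t ^+ kappa / (qexp Q kappa.+1)%:R].
Proof.
move=> q t r cdiv Z.
have ZE : Z = Ig (zpow T[i] c * gsubst (unifg T[i] K) b * stepg T ell Q omega 0).
  rewrite -genf_qtotal //; apply: (igusa_zeta_Ig hmu (quadpoly_cls L c)).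
  by move=> k; exact: gphi_quadpoly.
rewrite ZE {Z ZE mu hmu}.
(* A linear coefficient divisible by [pi^(2 ell+1)] leaves no trace beside the head; this is where
   [I_a] replaces [I_a^mu]. *)
have absorb i s : s \in unif_ideal (2 * ell).+1 ->
    gsubst (unifg T[i] K) s * Iprod T ell (qbold Q i) = Iprod T ell (qbold Q i).
  by move=> hs; rewrite mulrC Iprod_absorb // geval1_unifg.
split.
- move=> L0 c0; have b0 : b = 0.
    case: hL => [[]//|[j]]; rewrite L0 => /matrixP/(_ 0 j).
    by rewrite !mxE !eqxx mulr1.
  rewrite c0 b0 zpow0 gsubst_by0 ?geval1_unifg // mul1r.
  (* The recursion stops at [w = omega - 1], from where [F_i] has period two. *)
  case: omega omega_gt0 Qomega @r {hL L L0} => // w _ hw r.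
  rewrite (Ig_iter hell Quni hw (V := fun=> 1) (n := w)) => [|i _]; last by rewrite gsubst1.
  apply: (f_equal2 +%R); first by apply: eq_bigr => i _; rewrite /Ipt zpow0.
  rewrite -[w.+1.-1]/w.
  rewrite [1 * stepg _ _ _ _ _]mul1r (Ig_periodic T hell Quni hw) // /Ipt zpow0.
  rewrite [1 * Iprod _ _ (qpair (qpar Q w) _)]mul1r [1 * Iprod _ _ _]mul1r.
  rewrite !(Iprod_qpair ell hw (T := T)) //; last by rewrite (genf_qpar_omega T hw).
  by rewrite t_qexpS -[X in _ = (_ + X) * _]mulrA -mulrDr mulrA.
- move=> lambda hb hc; have [u uu bE] := vpi_eq_nat hb.
  have /unif_idealP[c' cE] : c \in unif_ideal lambda by rewrite unif_idealE -hb.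
  pose V i := gsubst (unifg T[i] K) (vr_unif K ^+ (lambda - i)).
  (* Since [pi^lambda] divides [c], the uniform factor absorbs [z^c]; the unit part of [b] only
     permutes residues. *)
  have -> : zpow T[i] c * gsubst (unifg T[i] K) b = V 0%N.
    rewrite bE gsubst_unifg_unit // -[c]mulr1 -gsubst_zpow cE mulrC.
    by rewrite gsubst_unifgM ?geval1_zpow // /V subn0.
  rewrite (Ig_iter hell Quni Qomega (n := lambda)) => [|i il]; last first.
    by rewrite /V gsubst_comp -exprS subnSK.
  rewrite max0n (@big_cat_nat _ _ _ (lambda - 2 * ell)); first last; [by lia|by []|].
  apply: (f_equal2 +%R); first apply: (f_equal2 +%R).
  (* For [i < lambda - 2 ell] the exponent [lambda - i] exceeds [2 ell]. *)
  + rewrite big_nat_cond [RHS]big_nat_cond; apply: eq_bigr => i /andP[/andP[_ hi] _].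
    by rewrite /Ipt zpow0 mul1r /V absorb //; apply: unifXE; lia.
  + apply: eq_bigr => i _.
    by rewrite /Icoset zpow_cosetE zpow0 mul1r.
  (* At [i = lambda] the linear coefficient has become 1, and the uniform element absorbs all of
     [F_lambda]. *)
  + by rewrite /V subnn gsubst_id unifgM ?geval1_stepg // Ig_unifg.
- move=> lambda kappa hb hc; rewrite hb hc !lee_fin !lte_fin => kl lk.
  have [u uu bE] := vpi_eq_nat hb; have [u' uu' cE] := vpi_eq_nat hc.
  pose beta i := vr_unif K ^+ (lambda - i).
  have -> : gsubst (unifg T[i] K) b = gsubst (unifg T[i] K) (beta 0%N).
    by rewrite bE gsubst_unifg_unit // /beta subn0.
  rewrite /cdiv cE (Ig_iter_unit T hell Quni Qomega uu'); first last.
  + by apply: unifXE; lia.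
  + by move=> i ik; rewrite /beta -exprS subnSK //; lia.
  (* The bound [v(b) <= v(c) + 2 ell] places the cut [lambda - 2 ell] at or below [kappa]. *)
  rewrite max0n (@big_cat_nat _ _ _ (lambda - 2 * ell)); first last; [by lia|by []|].
  apply: (f_equal2 +%R); last by [].
  apply: (f_equal2 +%R).
    rewrite big_nat_cond [RHS]big_nat_cond; apply: eq_bigr => i /andP[/andP[_ hi] _].
    by rewrite /Ipt -[X in _ * Ig X = _]mulrA absorb //; apply: unifXE; lia.
  by apply: eq_bigr => i _; rewrite /Icoset zpow_cosetE.
- move=> kappa hc; rewrite hc => hb; have [u uu cE] := vpi_eq_nat hc.
  (* Even [b / pi^kappa] is divisible by [pi^(2 ell+1)], so the linear factor is absorbed at every
     step. As [b] may be 0, the cofactor [w] need not be a unit. *)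
  have /unif_idealP[w bE] : b \in unif_ideal (kappa + (2 * ell).+1).
    rewrite unif_idealE; move: hb; case: (vpi b) => [n| |] //; rewrite ?leey //.
    by rewrite -EFinD lte_fin lee_fin; lia.
  pose beta i := vr_unif K ^+ (kappa - i + (2 * ell).+1) * w.
  have -> : b = beta 0%N by rewrite bE /beta subn0.
  rewrite /cdiv cE (Ig_iter_unit T hell Quni Qomega uu); first last.
  + by rewrite /beta mulrC unif_idealMr // unifXE //; lia.
  + by move=> i ik; rewrite /beta mulrA -exprS -addSn subnSK.
  apply: (f_equal2 +%R); last by [].
  apply: eq_bigr => i _; rewrite /Ipt -[X in _ * Ig X = _]mulrA absorb //.
  by rewrite /beta mulrC unif_idealMr // unifXE //; lia.
Qed.
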